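(* Let $(L,A,\omega)$ be a symplectic Lie pair over $\mathbb K\in\{\mathbb R,\mathbb C\}$, and let $\nabla$ be an $L$-connection on $L/A$ extending the $A$-action. Then: (1) the Atiyah class $\tilde\alpha_{L/A}=[\tilde R^\nabla]$ of $(L,A,\omega)$ lies in $H^1(A,S^3((L/A)^* ))$; (2) when $\nabla$ is symplectic, the 1-cocycle $\tilde R^\nabla$ itself has totally symmetric image, i.e. $\tilde R^\nabla\in\Omega^1(A,S^3((L/A)^* ))$.
   Context: A Lie algebroid over $\mathbb K$ is a $\mathbb K$-vector bundle $L\to M$ with anchor $\rho:L\to TM\otimes_{\mathbb R}\mathbb K$ and a Lie bracket on $\Gamma(L)$ satisfying the Leibniz rule; $d_L$ is its differential on $\Gamma(\Lambda^\bullet L^* )$. A Lie pair $(L,A)$ is a Lie algebroid $L$ with a Lie subalgebroid $A$ over the same base; $p:L\to L/A$, $l\mapsto\bar l$, is the projection. $L/A$ is an $A$-module (flat $A$-connection) via $\nabla^A_a\bar l=\overline{[a,l]}$, as are its duals and tensor powers. For an $A$-module $E$, $\Omega^k(A,E)=\Gamma(\Lambda^kA^*\otimes E)$ carries the Chevalley–Eilenberg differential $\partial^A$ with cohomology $H^\bullet(A,E)$. A symplectic Lie pair $(L,A,\omega)$ is a Lie pair with a non-degenerate $\omega\in\Gamma(\Lambda^2(L/A)^* )$ such that $d_L(p^*\omega)=0$. Put $\omega^\flat:L/A\to(L/A)^*$, $v\mapsto\iota_v\omega$. An $L$-connection $\nabla$ on $L/A$ extends the $A$-action if $\nabla_a\bar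 l=\overline{[a,l]}$ for all $a\in\Gamma(A)$, $l\in\Gamma(L)$. It is symplectic if it extends the $A$-action, its torsion $T(l_1,l_2)=\nabla_{l_1}\bar l_2-\nabla_{l_2}\bar l_1-\overline{[l_1,l_2]}$ vanishes, and $\nabla\omega=0$, where $(\nabla_{l_1}\omega)(\bar l_2,\bar l_3)=\rho(l_1)(\omega(\bar l_2,\bar l_3))-\omega(\nabla_{l_1}\bar l_2,\bar l_3)-\omega(\bar l_2,\nabla_{l_1}\bar l_3)$. For $\nabla$ extending the $A$-action, the Atiyah cocycle $R^\nabla\in\Omega^1(A,(L/A)^*\otimes(L/A)^*\otimes L/A)$ is $R^\nabla(a)(\bar l_1,\bar l_2)=(\nabla_a\nabla_{l_1}-\nabla_{l_1}\nabla_a-\nabla_{[a,l_1]})\bar l_2$. It is $\partial^A$-closed and its cohomology class $\alpha_{L/A}$ is independent of $\nabla$. Set $\tilde R^\nabla=(\mathrm{id}\otimes\mathrm{id}\otimes\omega^\flat)\circ R^\nabla\in\Omega^1(A,((L/A)^* )^{\otimes 3})$, which is also a cocycle (since $\omega^\flat$ is a map of $A$-modules), and let $\tilde\alpha_{L/A}=[\tilde R^\nabla]\in H^1(A,((L/A)^* )^{\otimes3})$. $S^3((L/A)^* )\subset((L/A)^* )^{\otimes 3}$ denotes the $A$-submodule of totally symmetric tensors; it is a direct summand, so $H^1(A,S^3((L/A)^* ))$ is regarded as a subspace of $H^1(A,((L/A)^* )^{\otimes 3})$. *)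

(* Defs.v *)
From mathcomp Require Import all_boot all_order all_algebra.
From mathcomp Require Import all_classical all_reals all_analysis.
From mathcomp Require Import complex.

Set Implicit Arguments.
Unset Strict Implicit.
Unset Printing Implicit Defensive.

Import Order.TTheory GRing.Theory Num.Theory.
Import numFieldNormedType.Exports.

Local Open Scope classical_set_scope.
Local Open Scope ring_scope.

Inductive base_field := RealBase | ComplexBase.

Definition base_scalar (R : realType) (k : base_field) : numFieldType :=
  match k with RealBase => R | ComplexBase => R[i] end.

Definition re_part (R : realType) (k : base_field) : base_scalar R k -> R :=
  match k with RealBase => id | ComplexBase => @complex.Re R end.

Definition im_part (R : realType) (k : base_field) : base_scalar R k -> R :=
  match k with RealBase => fun=> 0 | ComplexBase => @complex.Im R end.

(** [f] is of class C^k on [U]; used for open [U] only, so that the values of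
    [f] outside [U] are irrelevant. *)
Fixpoint class_C (R : realType) (n k : nat) (U : set 'rV[R]_n)
    (f : 'rV[R]_n -> R) : Prop :=
  match k with
  | 0 => forall x, U x -> {for x, continuous f}
  | k'.+1 => (forall x, U x -> differentiable f x) /\
             (forall v, class_C k' U ('D_v f))
  end.

Definition class_Coo (R : realType) (n : nat) (U : set 'rV[R]_n)
    (f : 'rV[R]_n -> R) : Prop := forall k, class_C k U f.

(** The smooth structure is given by an atlas, not necessarily maximal. The
    charts are total functions, meaningful on [mdom c] and [mcod c]. *)
Record manifold (R : realType) := Manifold {
  mspace :> topologicalType;
  mdim : nat;
  mhausdorff : hausdorff_space mspace;
  msecond_countable : @second_countable mspace;
  mchart : Type;
  mdom : mchart -> set mspace;
  mcod : mchart -> set 'rV[R]_mdim;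
  mmap : mchart -> mspace -> 'rV[R]_mdim;
  minv : mchart -> 'rV[R]_mdim -> mspace;
  mdom_open : forall c, open (mdom c);
  mcod_open : forall c, open (mcod c);
  mdom_cover : forall x, exists c, mdom c x;
  mmapP : forall c x, mdom c x -> mcod c (mmap c x) /\ minv c (mmap c x) = x;
  minvP : forall c u, mcod c u -> mdom c (minv c u) /\ mmap c (minv c u) = u;
  mmap_continuous : forall c x, mdom c x -> {for x, continuous (mmap c)};
  minv_continuous : forall c u, mcod c u -> {for u, continuous (minv c)};
  mtransition : forall c d j,
    class_Coo (mcod c `&` minv c @^-1` mdom d)
      (fun u => mmap d (minv c u) ord0 j)
}.

Section Geometry.
Variables (R : realType) (k : base_field) (M : manifold R).
Notation K := (base_scalar R k).

Definition smooth_real (U : set M) (f : M -> R) : Prop :=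
  forall c, class_Coo (@mcod R M c `&` @minv R M c @^-1` U)
                      (fun u => f (@minv R M c u)).

Definition smooth (U : set M) (f : M -> K) : Prop :=
  smooth_real U (fun x => re_part (f x)) /\
  smooth_real U (fun x => im_part (f x)).

(** A vector bundle, presented by a covering family of local frames, i.e. of
    local trivializations, with smooth transition matrices. *)
Record vector_bundle := VectorBundle {
  fibre :> M -> vectType K;
  brank : nat;
  bindex : Type;
  bdom : bindex -> set M;
  bframe : bindex -> forall x, brank.-tuple (fibre x);
  bdom_open : forall i, open (bdom i);
  bdom_cover : forall x, exists i, bdom i x;
  bframe_basis : forall i x, bdom i x -> basis_of fullv (bframe i x);
  btransition : forall i j r s,
    smooth (bdom i `&` bdom j)
      (fun x => coord (bframe i x) r (tnth (bframe j x) s))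
}.

Definition smooth_section (E : vector_bundle) (U : set M)
    (s : forall x, E x) : Prop :=
  forall i r, smooth (@bdom E i `&` U) (fun x => coord (@bframe E i x) r (s x)).

(** [T_x M (x) K] as the space of K-linear derivations at [x] of the algebra of
    smooth K-valued functions. *)
Definition tangent_vector (x : M) (D : (M -> K) -> K) : Prop :=
  (forall (c : K) f g, smooth setT f -> smooth setT g ->
     D (fun y => c * f y + g y) = c * D f + D g) /\
  (forall f g, smooth setT f -> smooth setT g ->
     D (fun y => f y * g y) = D f * g x + f x * D g).

(** The bracket is a total operation on set-theoretic sections; only its
    values on smooth ones matter. *)
Record lie_algebroid := LieAlgebroid {
  lbundle :> vector_bundle;
  anchor : forall x, lbundle x -> (M -> K) -> K;
  bracket : (forall x, lbundle x) -> (forall x, lbundle x) ->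
            forall x, lbundle x;
  anchor_tangent : forall x (v : lbundle x), tangent_vector x (anchor v);
  anchor_linear : forall x (c : K) (u v : lbundle x) f, smooth setT f ->
    anchor (c *: u + v) f = c * anchor u f + anchor v f;
  anchor_smooth : forall U l f, open U ->
    smooth_section U l -> smooth setT f ->
    smooth U (fun x => anchor (l x) f);
  bracket_smooth : forall l m, smooth_section setT l ->
    smooth_section setT m -> smooth_section setT (bracket l m);
  bracket_linear : forall (c : K) l m n, smooth_section setT l ->
    smooth_section setT m -> smooth_section setT n -> forall x,
    bracket (fun y => c *: l y + m y) n x = c *: bracket l n x + bracket m n x;
  bracket_antisym : forall l m, smooth_section setT l ->
    smooth_section setT m -> forall x, bracket l m x = - bracket m l x;
  bracket_jacobi : forall l m n, smooth_section setT l ->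
    smooth_section setT m -> smooth_section setT n -> forall x,
    bracket l (bracket m n) x + bracket m (bracket n l) x
      + bracket n (bracket l m) x = 0;
  bracket_leibniz : forall l m f, smooth_section setT l ->
    smooth_section setT m -> smooth setT f -> forall x,
    bracket l (fun y => f y *: m y) x
      = anchor (l x) f *: m x + f x *: bracket l m x
}.

(** The quotient bundle [L/A] is any bundle [quot_bundle] with a smooth,
    fibrewise surjective bundle map [quot_map] from [L] whose kernel is [A];
    this determines it up to a unique isomorphism of bundles under [L]. *)
Record lie_pair := LiePair {
  ambient : lie_algebroid;
  subalgebroid : forall x, {vspace ambient x};
  sub_subbundle : exists r : nat, forall x0, exists (U : set M)
      (e : forall x, r.-tuple (ambient x)),
    [/\ open U, U x0,
        forall j, smooth_section U (fun x => tnth (e x) j) &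
        forall x, U x -> basis_of (subalgebroid x) (e x)];
  sub_bracket : forall a b, smooth_section setT a -> smooth_section setT b ->
    (forall x, a x \in subalgebroid x) -> (forall x, b x \in subalgebroid x) ->
    forall x, bracket a b x \in subalgebroid x;
  quot_bundle : vector_bundle;
  quot_map : forall x, 'Hom(ambient x, quot_bundle x);
  quot_map_smooth : forall U l, open U -> smooth_section U l ->
    smooth_section U (fun x => quot_map x (l x));
  quot_map_surjective : forall x, limg (quot_map x) = fullv;
  quot_map_kernel : forall x, lker (quot_map x) = subalgebroid x
}.

Section Pair.
Variable P : lie_pair.
Notation L := (ambient P).
Notation Q := (quot_bundle P).
Notation Asec := (forall x, subvs_of (subalgebroid P x)).
Notation Lsec := (forall x, L x).
Notation Qsec := (forall x, Q x).

Definition bar (l : Lsec) : Qsec := fun x => quot_map P x (l x).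

Definition incl_sub (a : Asec) : Lsec := fun x => vsval (a x).

Definition smooth_subsection (U : set M) (a : Asec) : Prop :=
  smooth_section U (incl_sub a).

Definition bracketA (a b : Asec) : Asec :=
  fun x => vsproj (subalgebroid P x) (bracket (incl_sub a) (incl_sub b) x).

Definition two_form (w : forall x, Q x -> Q x -> K) : Prop :=
  [/\ forall x (c : K) u v t, w x (c *: u + v) t = c * w x u t + w x v t,
      forall x (c : K) u v t, w x t (c *: u + v) = c * w x t u + w x t v,
      forall x u, w x u u = 0 &
      forall U b1 b2, open U -> smooth_section U b1 -> smooth_section U b2 ->
        smooth U (fun x => w x (b1 x) (b2 x))].

Definition nondegenerate_form (w : forall x, Q x -> Q x -> K) : Prop :=
  forall x u, (forall v, w x u v = 0) -> u = 0.

Definition pullback2 (w : forall x, Q x -> Q x -> K) :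
    forall x, L x -> L x -> K :=
  fun x u v => w x (quot_map P x u) (quot_map P x v).

Definition d_L2 (t : forall x, L x -> L x -> K) (l1 l2 l3 : Lsec) (x : M) : K :=
  anchor (l1 x) (fun y => t y (l2 y) (l3 y))
  - anchor (l2 x) (fun y => t y (l1 y) (l3 y))
  + anchor (l3 x) (fun y => t y (l1 y) (l2 y))
  - t x (bracket l1 l2 x) (l3 x)
  + t x (bracket l1 l3 x) (l2 x)
  - t x (bracket l2 l3 x) (l1 x).

Definition symplectic_form (w : forall x, Q x -> Q x -> K) : Prop :=
  [/\ two_form w, nondegenerate_form w &
      forall l1 l2 l3, smooth_section setT l1 -> smooth_section setT l2 ->
        smooth_section setT l3 ->
        forall x, d_L2 (pullback2 w) l1 l2 l3 x = 0].

(** [L]-connections on [L/A]; as for the bracket, only values on smooth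
    sections matter. *)
Definition connection (D : Lsec -> Qsec -> Qsec) : Prop :=
  [/\ forall l b, smooth_section setT l -> smooth_section setT b ->
        smooth_section setT (D l b),
      forall f l m b, smooth setT f -> smooth_section setT l ->
        smooth_section setT m -> smooth_section setT b -> forall x,
        D (fun y => f y *: l y + m y) b x = f x *: D l b x + D m b x,
      forall l b c, smooth_section setT l -> smooth_section setT b ->
        smooth_section setT c -> forall x,
        D l (fun y => b y + c y) x = D l b x + D l c x &
      forall f l b, smooth setT f -> smooth_section setT l ->
        smooth_section setT b -> forall x,
        D l (fun y => f y *: b y) x
          = anchor (l x) f *: b x + f x *: D l b x].

Definition extends_action (D : Lsec -> Qsec -> Qsec) : Prop :=
  forall a l, smooth_subsection setT a -> smooth_section setT l ->
    forall x, D (incl_sub a) (bar l) x = bar (bracket (incl_sub a) l) x.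

Definition torsion (D : Lsec -> Qsec -> Qsec) (l1 l2 : Lsec) : Qsec :=
  fun x => D l1 (bar l2) x - D l2 (bar l1) x - bar (bracket l1 l2) x.

Definition nabla_form (D : Lsec -> Qsec -> Qsec)
    (w : forall x, Q x -> Q x -> K) (l1 l2 l3 : Lsec) (x : M) : K :=
  anchor (l1 x) (fun y => w y (bar l2 y) (bar l3 y))
  - w x (D l1 (bar l2) x) (bar l3 x)
  - w x (bar l2 x) (D l1 (bar l3) x).

Definition symplectic_connection (w : forall x, Q x -> Q x -> K)
    (D : Lsec -> Qsec -> Qsec) : Prop :=
  [/\ extends_action D,
      forall l1 l2, smooth_section setT l1 -> smooth_section setT l2 ->
        forall x, torsion D l1 l2 x = 0 &
      forall l1 l2 l3, smooth_section setT l1 -> smooth_section setT l2 ->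
        smooth_section setT l3 -> forall x, nabla_form D w l1 l2 l3 x = 0].

(** With [B] the dual bundle of [L/A], set-theoretic sections of [B^{(x)3}] and
    of the tensor product of the dual of [A] with [B^{(x)3}] are families of
    multilinear functions on the fibres. *)
Notation cubic := (forall x, Q x -> Q x -> Q x -> K).
Notation Acubic :=
  (forall x, subvs_of (subalgebroid P x) -> Q x -> Q x -> Q x -> K).

Definition trilinear (x : M) (t : Q x -> Q x -> Q x -> K) : Prop :=
  [/\ forall (c : K) u v y z, t (c *: u + v) y z = c * t u y z + t v y z,
      forall (c : K) u v y z, t y (c *: u + v) z = c * t y u z + t y v z &
      forall (c : K) u v y z, t y z (c *: u + v) = c * t y z u + t y z v].

(** [Omega^0(A, B^{(x)3})] *)
Definition cochain0 (n : cubic) : Prop :=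
  (forall x, trilinear (n x)) /\
  (forall U b1 b2 b3, open U -> smooth_section U b1 -> smooth_section U b2 ->
     smooth_section U b3 -> smooth U (fun x => n x (b1 x) (b2 x) (b3 x))).

(** [Omega^1(A, B^{(x)3})] *)
Definition cochain1 (s : Acubic) : Prop :=
  [/\ forall x (c : K) a b u v t,
        s x (c *: a + b) u v t = c * s x a u v t + s x b u v t,
      forall x a, trilinear (s x a) &
      forall U a b1 b2 b3, open U -> smooth_subsection U a ->
        smooth_section U b1 -> smooth_section U b2 -> smooth_section U b3 ->
        smooth U (fun x => s x (a x) (b1 x) (b2 x) (b3 x))].

(** Invariance under the two transpositions generating the symmetric group. *)
Definition symmetric3 (x : M) (t : Q x -> Q x -> Q x -> K) : Prop :=
  (forall u v y, t u v y = t v u y) /\ (forall u v y, t u v y = t u y v).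

(** [Omega^1(A, S^3 B)] *)
Definition sym_cochain1 (s : Acubic) : Prop :=
  cochain1 s /\ forall x a, symmetric3 (s x a).

Definition eval3 (n : cubic) (l1 l2 l3 : Lsec) : M -> K :=
  fun x => n x (bar l1 x) (bar l2 x) (bar l3 x).

Definition contract1 (s : Acubic) (a : Asec) : cubic := fun x => s x (a x).

(** The action of [a] on sections of [B^{(x)3}] induced by
    [nabla_a (bar l) = bar [a,l]], evaluated on [bar l1, bar l2, bar l3]. *)
Definition actA (a : Asec) (n : cubic) (l1 l2 l3 : Lsec) (x : M) : K :=
  anchor (incl_sub a x) (eval3 n l1 l2 l3)
  - eval3 n (bracket (incl_sub a) l1) l2 l3 x
  - eval3 n l1 (bracket (incl_sub a) l2) l3 x
  - eval3 n l1 l2 (bracket (incl_sub a) l3) x.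

(** The Chevalley-Eilenberg differential in degrees 0 and 1. *)
Definition d_A0 (n : cubic) (a : Asec) (l1 l2 l3 : Lsec) (x : M) : K :=
  actA a n l1 l2 l3 x.

Definition d_A1 (s : Acubic) (a b : Asec) (l1 l2 l3 : Lsec) (x : M) : K :=
  actA a (contract1 s b) l1 l2 l3 x
  - actA b (contract1 s a) l1 l2 l3 x
  - eval3 (contract1 s (bracketA a b)) l1 l2 l3 x.

Definition closed1 (s : Acubic) : Prop :=
  forall a b l1 l2 l3, smooth_subsection setT a -> smooth_subsection setT b ->
    smooth_section setT l1 -> smooth_section setT l2 ->
    smooth_section setT l3 -> forall x, d_A1 s a b l1 l2 l3 x = 0.

Definition cohomologous (s t : Acubic) : Prop :=
  exists2 n : cubic, cochain0 n &
  forall a l1 l2 l3, smooth_subsection setT a ->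
    smooth_section setT l1 -> smooth_section setT l2 ->
    smooth_section setT l3 -> forall x,
    eval3 (contract1 s a) l1 l2 l3 x - eval3 (contract1 t a) l1 l2 l3 x
      = d_A0 n a l1 l2 l3 x.

(** The 1-cochain [s] is closed and its class in [H^1(A, B^{(x)3})] lies in the
    image of [H^1(A, S^3 B)]. *)
Definition class_in_S3 (s : Acubic) : Prop :=
  [/\ cochain1 s, closed1 s &
      exists t : Acubic, [/\ sym_cochain1 t, closed1 t & cohomologous s t]].

(** [R^nabla(a)(bar l1, b)] *)
Definition atiyah (D : Lsec -> Qsec -> Qsec) (a : Asec) (l1 : Lsec) (b : Qsec) :
    Qsec :=
  fun x => D (incl_sub a) (D l1 b) x - D l1 (D (incl_sub a) b) x
           - D (bracket (incl_sub a) l1) b x.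

(** [s] is the cochain [(id (x) id (x) w^flat) o R^nabla]: the last slot is
    paired through [w^flat v = w(v, -)]. The formula on
    global sections determines [s]: every vector of [A], and of [L], extends
    to a global smooth section. *)
Definition tilde_atiyah (w : forall x, Q x -> Q x -> K)
    (D : Lsec -> Qsec -> Qsec) (s : Acubic) : Prop :=
  cochain1 s /\
  forall a l1 l2 l3, smooth_subsection setT a -> smooth_section setT l1 ->
    smooth_section setT l2 -> smooth_section setT l3 -> forall x,
    s x (a x) (bar l1 x) (bar l2 x) (bar l3 x)
      = w x (atiyah D a l1 (bar l2) x) (bar l3 x).

End Pair.
End Geometry.

(* Main.v *)
(** Let [T] be the torsion of [D]. Since [D] extends the action of [A] and [w]
    is closed, [T] and [nabla w] descend to tensors on [L/A], and
      [s(u,v,z) - s(v,u,z) = (d_A tau)(u,v,z)],   [tau(u,v,z) = w(T(u,v),z)],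
      [s(u,v,z) - s(u,z,v) = - (d_A c)(u,v,z)],   [c(u,v,z) = (nabla_u w)(v,z)],
    by the Jacobi identity and the invariance of [w]. If [D] is symplectic,
    [tau = c = 0] and [s] is symmetric. In general, the difference of [s] and
    its symmetrization is a combination of these differences, hence the
    coboundary of an explicit combination of [tau] and [c]; the inverse of [w]
    is never needed. Closedness of [s] is the Bianchi-type identity obtained
    from the flatness of the action of [A].

    Since brackets and connections act on global sections only, the tensors
    are built by extending vectors to global sections with bump functions. *)

Require Import Defs.
From mathcomp Require Import all_boot all_order all_algebra.
From mathcomp Require Import all_classical all_reals all_analysis.
From mathcomp Require Import complex ring lra.

Set Implicit Arguments.
Unset Strict Implicit.
Unset Printing Implicit Defensive.

Import Order.TTheory GRing.Theory Num.Theory.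
Import numFieldNormedType.Exports.

Local Open Scope classical_set_scope.
Local Open Scope ring_scope.

(** * Functions of class C^k *)

(** The two symmetry formulas and the closedness are the degenerate Bianchi identities of [D]. The
    torsion is the exterior covariant derivative of the projection [bar], so one more derivative
    gives the curvature applied to [bar]; on [(a, l1, l2)] with [bar a = 0] this is the first
    formula. The second is the curvature acting on [w], where [D_a w = 0]. Closedness is the second
    Bianchi identity on [(a, b, l)]. Two obstacles shape the rest. A vector has many global
    extensions, and a section of [L/A] lifts to [L] only near a given point. So independence of the
    choices is reduced to linearity over functions and vanishing on [A], and the anchor and [D] have
    to be shown local before a local lift may replace a section. Moreover, compatibility of the
    anchor with brackets is not a field of [lie_algebroid]; it is derived from the Jacobi identity
    and then cancels the second derivatives in the curvature and in the second formula. *)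

Lemma near_eq_continuous (S T : topologicalType) (f g : S -> T) (x : S) :
  (\near x, f x = g x) -> {for x, continuous f} -> {for x, continuous g}.
Proof.
move=> fg fc; have : f y @[y --> x] --> f x := fc.
rewrite (nbhs_singleton fg) => fx.
suff : g y @[y --> x] --> g x by [].
apply: cvg_trans fx; apply: near_eq_cvg; apply: filterS fg => y; exact.
Qed.

(** The first-order expansion of [f] at [x] depends only on its germ, so it is also one of [g];
    uniqueness of the differential then identifies ['d g x] with ['d f x]. *)
Lemma near_eq_differentiable (K : numFieldType) (V W : normedModType K)
    (f g : V -> W) (x : V) :
  (\near x, f x = g x) -> differentiable f x -> differentiable g x.
Proof.
move=> fg df; have fgx := nbhs_singleton fg.
have dgc : continuous ('d f x) by exact: diff_continuous.
have e : g \o shift x = cst (g x) + 'd f x +o_ 0 id.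
  apply/eqaddoP => _/posnumP[eps].
  have /eqaddoP/(_ _ [gt0 of eps%:num]) := diff_locally df.
  have fg' : \forall y \near 0, f (y + x) = g (y + x).
    by have := fg; rewrite (near_shift 0) /= subr0.
  apply: filterS2 fg' => y /= fgy.
  by rewrite !fctE /= fgy fgx.
by apply/diff_locallyP; rewrite (diff_unique dgc e); split.
Qed.

Section ClassC.
Variables (R : realType) (n : nat).
Implicit Types (U V : set 'rV[R]_n) (f g : 'rV[R]_n -> R) (k : nat).

Lemma class_C_sub k U V f : V `<=` U -> class_C k U f -> class_C k V f.
Proof.
move=> VU; elim: k f => [|k IH] f /= => [fc x /VU/fc //|[fd fD]].
by split=> [x /VU/fd //|v]; apply: IH.
Qed.

(** Every clause of [class_C] is tested pointwise, with derivatives taken in the whole space, so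
    gluing over a family of sets is formal. *)
Lemma class_CU (I : Type) (U : I -> set 'rV[R]_n) k f :
  (forall i, class_C k (U i) f) -> class_C k (\bigcup_i U i) f.
Proof.
elim: k f => [|k IH] f /= fU; first by move=> x [i _ /fU].
by split=> [x [i _ /(proj1 (fU i))]//|v]; apply: IH => i; apply: (fU i).2.
Qed.

Lemma class_CW k U f : class_C k.+1 U f -> class_C k U f.
Proof.
elim: k f => [|k IH] f; first by case=> fd _ x /fd /differentiable_continuous.
by case=> fd fD; split=> // v; apply: IH.
Qed.

(** On an open set, equality of values is equality of germs, so the directional derivatives agree on
    [U] too and the induction goes on. *)
Lemma eq_class_C k U f g : open U -> (forall x, U x -> f x = g x) ->
  class_C k U f -> class_C k U g.
Proof.
move=> oU; elim: k f g => [|k IH] f g fg.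
  move=> fc x Ux; apply: near_eq_continuous (fc x Ux).
  by apply: filterS (open_nbhs_nbhs (conj oU Ux)) => y /fg.
have nfg x : U x -> \near x, f x = g x.
  by move=> Ux; apply: filterS (open_nbhs_nbhs (conj oU Ux)) => y /fg.
move=> [fd fD]; split=> [x Ux|v].
  exact: near_eq_differentiable (nfg x Ux) (fd x Ux).
by apply: IH (fD v) => x /nfg /near_eq_derive.
Qed.

Lemma class_C_cst k U (c : R) : class_C k U (fun=> c).
Proof.
elim: k c => [|k IH] c /=; first by move=> x _; apply: cst_continuous.
split=> [x _|v]; first exact: differentiable_cst.
rewrite (_ : 'D_v _ = (fun=> 0)); first exact: IH.
by apply/funext => x; apply: derive_cst.
Qed.

Lemma class_CD k U f g : open U -> class_C k U f -> class_C k U g ->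
  class_C k U (fun x => f x + g x).
Proof.
move=> oU; elim: k f g => [|k IH] f g.
  by move=> fc gc x Ux; apply: continuousD; [apply: fc|apply: gc].
move=> [fd fD] [gd gD]; split=> [x Ux|v].
  by apply: differentiableD; [apply: fd|apply: gd].
apply: (@eq_class_C k U (fun x => 'D_v f x + 'D_v g x)) => //; last exact: IH (fD v) (gD v).
move=> x Ux; apply/esym.
exact: (deriveD (diff_derivable (fd x Ux)) (diff_derivable (gd x Ux))).
Qed.

Lemma class_CM k U f g : open U -> class_C k U f -> class_C k U g ->
  class_C k U (fun x => f x * g x).
Proof.
move=> oU; elim: k f g => [|k IH] f g.
  by move=> fc gc x Ux; apply: continuousM; [apply: fc|apply: gc].
move=> cf cg; have [[fd fD] [gd gD]] := (cf, cg); split=> [x Ux|v].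
  by apply: differentiableM; [apply: fd|apply: gd].
apply: (@eq_class_C k U (fun x => f x * 'D_v g x + g x * 'D_v f x)) => //.
  move=> x Ux; apply/esym.
  exact: (deriveM (diff_derivable (fd x Ux)) (diff_derivable (gd x Ux))).
exact: (class_CD oU (IH _ _ (class_CW cf) (gD v)) (IH _ _ (class_CW cg) (fD v))).
Qed.

Lemma class_CV k U f : open U -> (forall x, U x -> f x != 0) ->
  class_C k U f -> class_C k U (fun x => (f x)^-1).
Proof.
move=> oU f0; elim: k => [|k IH] cf.
  by move=> x Ux; apply: (continuousV (f0 x Ux)); apply: cf.
have [fd fD] := cf; split=> [x Ux|v].
  by apply: differentiableV; [apply: fd|apply: f0].
apply: (@eq_class_C k U
  (fun x => -1 * (((f x)^-1 * (f x)^-1) * 'D_v f x))) => //.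
  move=> x Ux; rewrite deriveV ?f0 //; last by apply: diff_derivable; exact: fd.
  by rewrite /GRing.scale /= mulN1r mulNr -invfM expr2.
have cV := IH (class_CW cf).
apply: class_CM => //; first exact: class_C_cst.
exact: class_CM oU (class_CM oU cV cV) (fD v).
Qed.

End ClassC.

(* [t^-m exp(-1/t)] for [t > 0], extended by [0]; a family closed under
   derivation, up to linear combinations. *)
Definition flat_fun (R : realType) (m : nat) (t : R) : R :=
  if 0 < t then t^-1 ^+ m * expR (- t^-1) else 0.

(** With [s = 1/t], the term of degree [m + 2] in the exponential series gives
    [s^(m+2) exp(-s) <= (m+2)!]. The factor [t^2] is chosen so that the difference quotient at 0
    still tends to 0. *)
Lemma flat_fun_bound (R : realType) (m : nat) (t : R) : 0 <= t ->
  `|flat_fun m t| <= (m.+2)`!%:R * t ^+ 2.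
Proof.
rewrite le_eqVlt /flat_fun => /predU1P[<-|t0].
  by rewrite ltxx normr0 expr2 !mulr0.
rewrite t0 ger0_norm; last by rewrite mulr_ge0 ?expR_ge0// exprn_ge0 ?invr_ge0 ?ltW.
set s := t^-1; have s0 : 0 < s by rewrite invr_gt0.
have tE : t = s^-1 by rewrite invrK.
rewrite tE expRN ler_pdivrMr ?expR_gt0 //.
have := @expR_ge1Dxn R s m.+1 (ltW s0).
have f0 : 0 < (m.+2)`!%:R :> R by rewrite ltr0n fact_gt0.
move=> h; have {}h : s ^+ m.+2 <= (m.+2)`!%:R * expR s.
  rewrite -ler_pdivrMl // mulrC; apply: le_trans h; rewrite lerDr //.
by rewrite mulrAC (exprVn s 2) ler_pdivlMr ?exprn_gt0 // -exprD addn2.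
Qed.

Lemma flat_fun_derive (R : realType) (m : nat) (t : R) :
  is_derive t 1 (@flat_fun R m)
    (flat_fun m.+2 t - m%:R * flat_fun m.+1 t).
Proof.
have [t0|t0|<-] := ltrgtP 0 t.
- have -> : flat_fun m.+2 t - m%:R * flat_fun m.+1 t =
    t^-1 ^+ m.+2 * expR (- t^-1) - m%:R * (t^-1 ^+ m.+1 * expR (- t^-1)).
    by rewrite /flat_fun t0.
  have := @near_eq_is_derive _ _ _ (fun u : R => u^-1 ^+ m * expR (- u^-1))
    (flat_fun m) t 1; apply.
    near=> u; rewrite /flat_fun ifT //; near: u; exact: lt_nbhsr.
  have t1 : t != 0 by rewrite gt_eqF.
  have dV : is_derive t 1 (fun u : R => u^-1) (- t^-1 ^+ 2).
    apply: DeriveDef; first by apply: derivableV.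
    by rewrite deriveV // derive_id /GRing.scale /= mulr1 exprVn.
  have dE : is_derive t 1 (fun u : R => expR (- u^-1))
      (t^-1 ^+ 2 * expR (- t^-1)).
    have dN := is_deriveN dV.
    have := @is_derive1_comp _ expR (- (fun u : R => u^-1)) t _ _ _ dN.
    move=> /(_ _ (is_derive_expR _)) h; refine (is_derive_eq h _).
    by rewrite opprK mulrC.
  have dX := is_deriveX m dV.
  have -> : (fun u : R => u^-1 ^+ m * expR (- u^-1)) =
      (fun u => u^-1) ^+ m * (fun u => expR (- u^-1)) by rewrite !fctE.
  refine (is_derive_eq (is_deriveM dX dE) _).
  rewrite !fctE /GRing.scale /=.
  move: (t^-1) (expR _) => u e; case: (m) => [|k] /=.
    by rewrite mulr0n !expr0 !mul0r mulr0 addr0 subr0 mul1r.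
  by rewrite !exprS; ring.
- have -> : flat_fun m.+2 t - m%:R * flat_fun m.+1 t = 0.
    by rewrite /flat_fun (lt_gtF t0) mulr0 subr0.
  have := @near_eq_is_derive _ _ _ (cst 0) (flat_fun m) t 1; apply.
  near=> u; rewrite /flat_fun lt_gtF //; near: u; exact: lt_nbhsl.
- have -> : flat_fun m.+2 0 - m%:R * flat_fun m.+1 0 = 0 :> R.
    by rewrite /flat_fun ltxx mulr0 subr0.
  set f := flat_fun m.
  (* At 0 the expected derivative is 0. The quotient vanishes for [h < 0], and for [h > 0] it is at
     most [(m+2)! h] by [flat_fun_bound]. *)
  have h0 : h^-1 *: ((f \o shift 0) (h *: 1) - f 0) @[h --> 0^'] --> (0 : R).
    apply/cvgr0Pnorm_le => e e0.
    have F0 : 0 < (m.+2)`!%:R :> R by rewrite ltr0n fact_gt0.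
    near=> h; have hn0 : h != 0 by near: h; exact: nbhs_dnbhs_neq.
    rewrite /f /= addr0 /GRing.scale /= mulr1 [flat_fun m 0]/flat_fun ltxx subr0.
    have : `|h| <= e / (m.+2)`!%:R by near: h; apply: dnbhs0_le; exact: divr_gt0.
    rewrite ler_pdivlMr // => he.
    have [hp|hp] := ltP 0 h; last first.
      by rewrite /flat_fun ltNge hp /= mulr0 normr0 ltW.
    rewrite normrM normfV ler_pdivrMl ?normr_gt0 //.
    apply: le_trans (flat_fun_bound _ (ltW hp)) _.
    rewrite (gtr0_norm hp) in he *.
    by rewrite expr2 mulrCA; apply: ler_wpM2l; [exact: ltW|rewrite mulrC].
  by apply: DeriveDef; [apply/cvg_ex; exists 0|apply: cvg_lim].
Unshelve. all: by end_near. Qed.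

Section FlatComp.
Variables (R : realType) (n : nat).
Implicit Types (U : set 'rV[R]_n) (f : 'rV[R]_n -> R).

Lemma derive_comp1 (h : R -> R) (dh : R) f (x v : 'rV[R]_n) :
  differentiable f x -> is_derive (f x) 1 h dh ->
  differentiable (h \o f) x /\ 'D_v (h \o f) x = dh * 'D_v f x.
Proof.
move=> df [hd hE]; have dfh : differentiable h (f x) by apply/derivable1_diffP.
have dhf := differentiable_comp df dfh; split=> //.
rewrite !deriveE // diff_comp //= diff1E // derive1E hE.
by rewrite /GRing.scale /= mulrC.
Qed.

(** The induction on [k] leaves [m] free, because differentiating raises it to [m + 1] and
    [m + 2]. *)
Lemma class_C_flat k U f m : open U -> class_C k U f ->
  class_C k U (fun x => flat_fun m (f x)).
Proof.
move=> oU; elim: k m => [|k IH] m cf.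
  move=> x Ux; have [d _] := flat_fun_derive m (f x).
  have dh : differentiable (flat_fun m) (f x) by apply/derivable1_diffP.
  exact: (continuous_comp (cf x Ux) (differentiable_continuous dh)).
have [fd fD] := cf; split=> [x Ux|v].
  exact: (derive_comp1 0 (fd x Ux) (flat_fun_derive m (f x))).1.
apply: (@eq_class_C _ _ k U
  (fun x => (flat_fun m.+2 (f x) + - m%:R * flat_fun m.+1 (f x)) * 'D_v f x)) => //.
  move=> x Ux; rewrite mulNr; apply/esym.
  exact: (derive_comp1 v (fd x Ux) (flat_fun_derive m (f x))).2.
have cf' := class_CW cf.
apply: class_CM (fD v) => //; apply: class_CD (IH _ cf') _ => //.
exact: class_CM oU (class_C_cst _ _ _) (IH _ cf').
Qed.

End FlatComp.

(** * Smooth functions and bump functions on a manifold *)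

Section SmoothReal.
Variables (R : realType) (M : manifold R).
Implicit Types (U V : set M) (f g : M -> R).

Lemma chart_preimage_open (c : mchart M) U : open U ->
  open (@mcod R M c `&` @minv R M c @^-1` U).
Proof.
move=> oU; rewrite openE => u [cu Uu].
apply: filterI; first exact: open_nbhs_nbhs (conj (@mcod_open R M c) cu).
by apply: (minv_continuous cu); apply: open_nbhs_nbhs.
Qed.

Lemma smooth_real_sub U V f : V `<=` U -> smooth_real U f -> smooth_real V f.
Proof. by move=> VU fU c k; apply: class_C_sub (fU c k) => u [cu /VU]. Qed.

Lemma smooth_realU (I : Type) (U : I -> set M) f :
  (forall i, smooth_real (U i) f) -> smooth_real (\bigcup_i U i) f.
Proof.
move=> fU c k; rewrite preimage_bigcup setI_bigcupr.
by apply: class_CU => i; apply: fU.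
Qed.

Lemma eq_smooth_real U f g : open U -> (forall x, U x -> f x = g x) ->
  smooth_real U f -> smooth_real U g.
Proof.
move=> oU fg fU c k; apply: eq_class_C (fU c k); first exact: chart_preimage_open.
by move=> u [_ Uu]; apply: fg.
Qed.

Lemma smooth_real_cst U (a : R) : smooth_real U (fun=> a).
Proof. by move=> c k; apply: class_C_cst. Qed.

Lemma smooth_realD U f g : open U -> smooth_real U f -> smooth_real U g ->
  smooth_real U (fun x => f x + g x).
Proof.
by move=> oU fU gU c k; apply: class_CD; [exact: chart_preimage_open|exact: fU|exact: gU].
Qed.

Lemma smooth_realM U f g : open U -> smooth_real U f -> smooth_real U g ->
  smooth_real U (fun x => f x * g x).
Proof.
by move=> oU fU gU c k; apply: class_CM; [exact: chart_preimage_open|exact: fU|exact: gU].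
Qed.

Lemma smooth_realN U f : open U -> smooth_real U f -> smooth_real U (fun x => - f x).
Proof.
move=> oU fU; have := smooth_realM oU (smooth_real_cst U (-1)) fU.
by apply: eq_smooth_real => // x _; rewrite mulN1r.
Qed.

Lemma smooth_realV U f : open U -> (forall x, U x -> f x != 0) ->
  smooth_real U f -> smooth_real U (fun x => (f x)^-1).
Proof.
move=> oU f0 fU c k; apply: class_CV; [exact: chart_preimage_open| |exact: fU].
by move=> u [_ Uu]; apply: f0.
Qed.

Lemma smooth_real_flat U f m : open U -> smooth_real U f ->
  smooth_real U (fun x => flat_fun m (f x)).
Proof.
by move=> oU fU c k; apply: class_C_flat; [exact: chart_preimage_open|exact: fU].
Qed.

Lemma smooth_real_chart (d : mchart M) (j : 'I_(mdim M)) :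
  smooth_real (@mdom R M d) (fun x => mmap d x ord0 j).
Proof. by move=> c; apply: mtransition. Qed.

Lemma smooth_real_sum (I : Type) (s : seq I) U (f : I -> M -> R) : open U ->
  (forall i, smooth_real U (f i)) -> smooth_real U (fun x => \sum_(i <- s) f i x).
Proof.
move=> oU fU; elim: s => [|i s IH].
  by apply: eq_smooth_real (smooth_real_cst U 0) => // x _; rewrite big_nil.
apply: eq_smooth_real (smooth_realD oU (fU i) IH) => // x _.
by rewrite big_cons.
Qed.

Lemma smooth_real_continuous U f x : open U -> U x -> smooth_real U f ->
  {for x, continuous f}.
Proof.
move=> oU Ux fU; have [d dx] := @mdom_cover R M x; have [cx ix] := mmapP dx.
have /(_ (mmap d x)) fc := fU d 0%N.
have {}fc : {for mmap d x, continuous (fun u => f (@minv R M d u))}.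
  by apply: fc; split=> //; rewrite /= ix.
have nd := open_nbhs_nbhs (conj (@mdom_open R M d) dx).
apply: near_eq_continuous (continuous_comp (mmap_continuous dx) fc).
by apply: filterS nd => y /mmapP[_ /= ->].
Qed.

Lemma dist2_continuous n (p : 'rV[R]_n) :
  continuous (fun u : 'rV[R]_n => \sum_j (u ord0 j - p ord0 j) ^+ 2).
Proof.
move=> u; elim: (index_enum _) => [|j s IH].
  apply: near_eq_continuous (@cst_continuous _ _ 0 u).
  by near=> v; rewrite big_nil.
have cj : {for u, continuous (fun v : 'rV[R]_n => v ord0 j - p ord0 j)}.
  by apply: continuousB; [exact: coord_continuous|exact: cst_continuous].
apply: near_eq_continuous (continuousD (continuousM cj cj) IH).
by near=> v; rewrite big_cons expr2.
Unshelve. all: by end_near. Qed.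

(* In a chart centred at [x], [h(g) / (h(g) + h(r^2 / 2 - g))] with
   [g = r^2 - |.|^2] and [h = flat_fun 0]. *)
Lemma real_bump U (x : M) : open U -> U x -> exists f : M -> R,
  [/\ smooth_real setT f,
      exists C, [/\ closed C, C `<=` U & forall y, ~ C y -> f y = 0] &
      \forall y \near x, f y = 1].
Proof.
move=> oU Ux; have [d dx] := @mdom_cover R M x; have [cx ix] := mmapP dx.
set p := mmap d x.
have oW := @chart_preimage_open d U oU.
have Wp : (@mcod R M d `&` @minv R M d @^-1` U) p by split=> //; rewrite /= ix.
have /nbhs_ballP[e /= e0 eW] := open_nbhs_nbhs (conj oW Wp).
pose r := e / 2; have r0 : 0 < r by rewrite divr_gt0.
pose B := [set u : 'rV[R]_(mdim M) |
  forall j, `[p ord0 j - r, p ord0 j + r]%classic (u ord0 j)].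
have cB : compact B.
  by apply: (@rV_compact R _ (fun j => `[p ord0 j - r, p ord0 j + r]%classic)) => j;
    exact: segment_compact.
have BW : B `<=` @mcod R M d `&` @minv R M d @^-1` U.
  move=> u Bu; apply: eW; split=> // i j; rewrite !ord1.
  have := Bu j; rewrite /= in_itv /= => /andP[h1 h2].
  rewrite -ball_normE /= ltr_norml; rewrite /r in h1 h2.
  by apply/andP; split; lra.
(* A compact box read in [M] is closed because [M] is Hausdorff; this gives an open complement on
   which the bump can be 0. *)
pose C := @minv R M d @` B.
have clC : closed C.
  apply: compact_closed; first exact: mhausdorff.
  apply: continuous_compact => //; apply: continuous_in_subspaceT => u.
  by rewrite inE => /BW[cu _]; apply: minv_continuous.
(* Inside the chart, [g y > 0] bounds every coordinate of [y] relative to [x] by [r], which puts [y]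
   into [C]. *)
pose g (y : M) := r ^+ 2 - \sum_j (mmap d y ord0 j - p ord0 j) ^+ 2.
have gC y : @mdom R M d y -> 0 < g y -> C y.
  move=> dy gy; exists (mmap d y); last by have [] := mmapP dy.
  move=> j; rewrite /= in_itv /=.
  have : (mmap d y ord0 j - p ord0 j) ^+ 2 < r ^+ 2.
    apply: le_lt_trans (_ : \sum_j (mmap d y ord0 j - p ord0 j) ^+ 2 < _).
      by rewrite (bigD1 j) //= lerDl sumr_ge0 // => i _; apply: sqr_ge0.
    by rewrite -subr_gt0.
  rewrite -(real_normK (num_real (_ - _))) ltr_sqr ?nnegrE ?(ltW r0) //.
  by rewrite ltr_norml => /andP[h1 h2]; apply/andP; split; lra.
have sg : smooth_real (@mdom R M d) g.
  have od := @mdom_open R M d.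
  apply: smooth_realD => //; first exact: smooth_real_cst.
  apply: smooth_realN => //; apply: smooth_real_sum => // j.
  apply: (@eq_smooth_real _ (fun y =>
    (mmap d y ord0 j + - p ord0 j) * (mmap d y ord0 j + - p ord0 j))) => //.
  by apply: smooth_realM => //; apply: smooth_realD => //;
    first [exact: smooth_real_chart|exact: smooth_real_cst].
pose h := @flat_fun R 0.
have h_gt0 t : 0 < t -> 0 < h t.
  by move=> t0; rewrite /h /flat_fun t0 expr0 mul1r expR_gt0.
have h_eq0 t : t <= 0 -> h t = 0 by move=> t0; rewrite /h /flat_fun ltNge t0.
have h_ge0 t : 0 <= h t.
  by have [/h_gt0/ltW//|/h_eq0->] := ltP 0 t.
pose den (y : M) := h (g y) + h (r ^+ 2 / 2 - g y).
have r2 : 0 < r ^+ 2 by rewrite exprn_gt0.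
(* If [g y <= 0], the second argument is at least [r^2 / 2], so one of the two summands is always
   positive. Where [g y > r^2 / 2], in particular near [x], the second summand vanishes and the
   quotient is 1. *)
have den0 y : den y != 0.
  rewrite gt_eqF // /den; have [gy|gy] := ltP 0 (g y).
    by rewrite ltr_pwDl // h_gt0.
  by rewrite ltr_wpDl // h_gt0 // subr_gt0; lra.
pose f y := if `[< @mdom R M d y >] then h (g y) / den y else 0.
exists f; split.
(* The chart domain and the complement of [C] are open and cover [M], as [C] lies in the domain; on
   their overlap [h (g y) = 0], so the quotient and the constant 0 agree. *)
- apply: (@smooth_real_sub (\bigcup_(b : bool) (if b then @mdom R M d else ~` C))).
    move=> y _; have [dy|dy] := pselect (@mdom R M d y); first by exists true.
    by exists false => // -[u Bu uy]; apply: dy; rewrite -uy; have [/minvP[]] := BW u Bu.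
  apply: smooth_realU => -[].
    apply: (@eq_smooth_real _ (fun y => h (g y) / den y)); first exact: mdom_open.
      by move=> y dy; rewrite /f; case: asboolP.
    have od := @mdom_open R M d.
    apply: smooth_realM => //; first exact: smooth_real_flat.
    apply: smooth_realV => //; apply: smooth_realD => //; first exact: smooth_real_flat.
    apply: smooth_real_flat => //; apply: smooth_realD => //; first exact: smooth_real_cst.
    exact: smooth_realN.
  apply: eq_smooth_real (smooth_real_cst _ 0); first exact: closed_openC.
  move=> y nC; rewrite /f; case: asboolP => // dy.
  by rewrite h_eq0 ?mul0r // leNgt; apply/negP => /(gC y dy).
- exists C; split=> //; first by move=> _ [u /BW[_ Uu] <-].
  move=> y nC; rewrite /f; case: asboolP => // dy.
  by rewrite h_eq0 ?mul0r // leNgt; apply/negP => /(gC y dy).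
- have cg : {for x, continuous g}.
    apply: (@continuous_comp _ _ _ (mmap d)
      (fun u => r ^+ 2 - \sum_j (u ord0 j - p ord0 j) ^+ 2)); first exact: mmap_continuous.
    apply: continuousB; first exact: cst_continuous.
    exact: dist2_continuous.
  have gx : g x = r ^+ 2.
    by rewrite /g big1 ?subr0 // => j _; rewrite subrr expr0n.
  have ngx : \forall y \near x, r ^+ 2 / 2 < g y.
    by apply: (cvgr_gt (g x)) => //; rewrite gx; lra.
  near=> y; have dy : @mdom R M d y.
    by near: y; exact: open_nbhs_nbhs (conj (@mdom_open R M d) dx).
  have gy : r ^+ 2 / 2 < g y by near: y.
  have g0 : 0 < g y by apply: lt_trans gy; rewrite divr_gt0.
  rewrite /f asboolT // /den (h_eq0 (_ - g y)); first by rewrite addr0 divff ?gt_eqF ?h_gt0.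
  by rewrite subr_le0 ltW.
Unshelve. all: by end_near. Qed.

End SmoothReal.

(** * Smooth functions with values in the base field *)

Section Smooth.
Variables (R : realType) (k : base_field) (M : manifold R).
Notation K := (base_scalar R k).
Implicit Types (U V : set M) (f g : M -> K).

Definition real_scalar (a : R) : K :=
  match k return base_scalar R k with
  | RealBase => a
  | ComplexBase => Complex a 0
  end.

Lemma real_scalar1 : real_scalar 1 = 1.
Proof. by rewrite /real_scalar; case: k. Qed.

Lemma real_scalar0 : real_scalar 0 = 0.
Proof. by rewrite /real_scalar; case: k. Qed.

Lemma re_real_scalar a : re_part (real_scalar a) = a.
Proof. by rewrite /re_part /real_scalar; case: k. Qed.

Lemma im_real_scalar a : im_part (real_scalar a) = 0.
Proof. by rewrite /im_part /real_scalar; case: k. Qed.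

Lemma re_partD (a b : K) : re_part (a + b) = re_part a + re_part b.
Proof. by move: a b; rewrite /re_part; case: k => // -[a1 a2] [b1 b2]. Qed.

Lemma im_partD (a b : K) : im_part (a + b) = im_part a + im_part b.
Proof. by move: a b; rewrite /im_part; case: k => [|[a1 a2] [b1 b2]] //= *; rewrite addr0. Qed.

Lemma re_partM (a b : K) :
  re_part (a * b) = re_part a * re_part b - im_part a * im_part b.
Proof.
by move: a b; rewrite /re_part /im_part; case: k => [|[a1 a2] [b1 b2]] //= *; rewrite mulr0 subr0.
Qed.

Lemma im_partM (a b : K) :
  im_part (a * b) = re_part a * im_part b + im_part a * re_part b.
Proof.
by move: a b; rewrite /re_part /im_part; case: k => [|[a1 a2] [b1 b2]] //= *; rewrite mulr0 mul0r addr0.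
Qed.

(** The squared modulus: the inverse of a scalar is its conjugate divided by this real number, which
    reduces inverses in [K] to real ones. *)
Definition sqnorm (a : K) := re_part a * re_part a + im_part a * im_part a.

Lemma sqnorm_neq0 (a : K) : a != 0 -> sqnorm a != 0.
Proof.
move: a; rewrite /sqnorm /re_part /im_part; case: k => [a a0|[a1 a2] a0] /=.
  by rewrite mulr0 addr0 mulf_neq0.
rewrite -!expr2 paddr_eq0 ?sqr_ge0 // !sqrf_eq0; apply: contra_neqN a0.
by move=> /andP[/eqP-> /eqP->].
Qed.

Lemma re_partV (a : K) : re_part a^-1 = re_part a * (sqnorm a)^-1.
Proof.
move: a; rewrite /sqnorm /re_part /im_part; case: k => [a|[a1 a2]] /=.
  rewrite mulr0 addr0; have [->|a0] := eqVneq a 0; first by rewrite invr0 mul0r.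
  by rewrite invfM mulrA divff // mul1r.
by rewrite !expr2.
Qed.

Lemma im_partV (a : K) : im_part a^-1 = - im_part a * (sqnorm a)^-1.
Proof.
move: a; rewrite /sqnorm /re_part /im_part; case: k => [a|[a1 a2]] /=.
  by rewrite oppr0 mul0r.
by rewrite !expr2 mulNr.
Qed.

Lemma smooth_sub U V f : V `<=` U -> smooth U f -> smooth V f.
Proof. by move=> VU [fr fi]; split; [apply: smooth_real_sub fr|apply: smooth_real_sub fi]. Qed.

Lemma smoothU (I : Type) (U : I -> set M) f :
  (forall i, smooth (U i) f) -> smooth (\bigcup_i U i) f.
Proof. by move=> fU; split; apply: smooth_realU => i; have [] := fU i. Qed.

Lemma eq_smooth U f g : open U -> (forall x, U x -> f x = g x) ->
  smooth U f -> smooth U g.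
Proof.
by move=> oU fg [fr fi]; split; [apply: eq_smooth_real fr|apply: eq_smooth_real fi] => // x /fg ->.
Qed.

Lemma smooth_cst U (a : K) : smooth U (fun=> a).
Proof. by split; apply: smooth_real_cst. Qed.

Lemma smoothD U f g : open U -> smooth U f -> smooth U g ->
  smooth U (fun x => f x + g x).
Proof.
move=> oU [fr fi] [gr gi]; split.
  by apply: eq_smooth_real (smooth_realD oU fr gr) => // x _; rewrite re_partD.
by apply: eq_smooth_real (smooth_realD oU fi gi) => // x _; rewrite im_partD.
Qed.

Lemma smoothM U f g : open U -> smooth U f -> smooth U g ->
  smooth U (fun x => f x * g x).
Proof.
move=> oU [fr fi] [gr gi]; split.
  have := smooth_realD oU (smooth_realM oU fr gr) (smooth_realN oU (smooth_realM oU fi gi)).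
  by apply: eq_smooth_real => // x _; rewrite re_partM.
have := smooth_realD oU (smooth_realM oU fr gi) (smooth_realM oU fi gr).
by apply: eq_smooth_real => // x _; rewrite im_partM.
Qed.

Lemma smoothN U f : open U -> smooth U f -> smooth U (fun x => - f x).
Proof.
move=> oU fU; apply: eq_smooth (smoothM oU (smooth_cst U (-1)) fU) => // x _.
by rewrite mulN1r.
Qed.

Lemma smoothB U f g : open U -> smooth U f -> smooth U g ->
  smooth U (fun x => f x - g x).
Proof. by move=> oU fU gU; apply: smoothD => //; apply: smoothN. Qed.

Lemma smoothV U f : open U -> (forall x, U x -> f x != 0) ->
  smooth U f -> smooth U (fun x => (f x)^-1).
Proof.
move=> oU f0 [fr fi].
have sn : smooth_real U (fun x => (sqnorm (f x))^-1).
  apply: smooth_realV => //; first by move=> x /f0 /sqnorm_neq0.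
  exact: smooth_realD oU (smooth_realM oU fr fr) (smooth_realM oU fi fi).
split.
  by apply: eq_smooth_real (smooth_realM oU fr sn) => // x _; rewrite re_partV.
apply: eq_smooth_real (smooth_realM oU (smooth_realN oU fi) sn) => // x _.
by rewrite im_partV.
Qed.

Lemma smooth_sum (I : Type) (s : seq I) (P : pred I) U (f : I -> M -> K) : open U ->
  (forall i, smooth U (f i)) -> smooth U (fun x => \sum_(i <- s | P i) f i x).
Proof.
move=> oU fU; elim: s => [|i s IH].
  by apply: eq_smooth (smooth_cst U 0) => // x _; rewrite big_nil.
have [Pi|Pi] := boolP (P i).
  by apply: eq_smooth (smoothD oU (fU i) IH) => // x _; rewrite big_cons Pi.
by apply: eq_smooth IH => // x _; rewrite big_cons (negbTE Pi).
Qed.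

Lemma smooth_prod (I : Type) (s : seq I) (P : pred I) U (f : I -> M -> K) : open U ->
  (forall i, smooth U (f i)) -> smooth U (fun x => \prod_(i <- s | P i) f i x).
Proof.
move=> oU fU; elim: s => [|i s IH].
  by apply: eq_smooth (smooth_cst U 1) => // x _; rewrite big_nil.
have [Pi|Pi] := boolP (P i).
  by apply: eq_smooth (smoothM oU (fU i) IH) => // x _; rewrite big_cons Pi.
by apply: eq_smooth IH => // x _; rewrite big_cons (negbTE Pi).
Qed.

Lemma smooth_det m U (A : M -> 'M[K]_m) : open U ->
  (forall i j, smooth U (fun x => A x i j)) -> smooth U (fun x => \det (A x)).
Proof.
move=> oU sA; apply: smooth_sum => // s; apply: smoothM => //; first exact: smooth_cst.
by apply: smooth_prod.
Qed.

Lemma smooth_cofactor m U (A : M -> 'M[K]_m) i j : open U ->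
  (forall i j, smooth U (fun x => A x i j)) ->
  smooth U (fun x => cofactor (A x) i j).
Proof.
move=> oU sA; apply: smoothM => //; first exact: smooth_cst.
apply: smooth_det => // i' j'.
by apply: eq_smooth (sA (lift i i') (lift j j')) => // x _; rewrite !mxE.
Qed.

Lemma smooth_local U f :
  (forall x, U x -> exists V, [/\ open V, V x & smooth V f]) -> smooth U f.
Proof.
move=> fU.
apply: (@smooth_sub (\bigcup_(V : {V : set M | smooth V f}) projT1 V)).
  by move=> x /fU[V [_ Vx fV]]; exists (exist _ V fV).
by apply: smoothU => -[].
Qed.

(** The criterion for tensors defined point by point: near each point they are compared with one
    function built from global sections. *)
Lemma smooth_near U f :
  (forall x, U x -> exists2 g, smooth setT g & \forall y \near x, f y = g y) ->
  smooth U f.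
Proof.
move=> fU; apply: smooth_local => x /fU[g sg /nbhs_interior fg].
exists (interior [set y | f y = g y]); split.
- exact: open_interior.
- exact: nbhs_singleton fg.
- apply: (@eq_smooth _ g); first exact: open_interior.
    by move=> y /interior_subset.
  exact: smooth_sub sg.
Qed.

(** Continuity is established for real-valued functions, hence the detour through [sqnorm]. *)
Lemma smooth_neq0_near U f x : open U -> U x -> smooth U f -> f x != 0 ->
  \forall y \near x, f y != 0.
Proof.
move=> oU Ux [fr fi] fx.
have cN : {for x, continuous (fun y => sqnorm (f y))}.
  have sN := smooth_realD oU (smooth_realM oU fr fr) (smooth_realM oU fi fi).
  exact: smooth_real_continuous sN.
have := sqnorm_neq0 fx => Nx.
have : \forall y \near x, sqnorm (f y) != 0.
  have ro : open [set a : R | a != 0] by apply: open_neq.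
  exact: (cN _ (open_nbhs_nbhs (conj ro Nx))).
apply: filterS => y; apply: contra_neqN => /eqP ->.
have : sqnorm (real_scalar 0) = 0.
  by rewrite /sqnorm re_real_scalar im_real_scalar mulr0 addr0.
by rewrite real_scalar0.
Qed.

Lemma bump U x : open U -> U x -> exists f,
  [/\ smooth setT f,
      exists C, [/\ closed C, C `<=` U & forall y, ~ C y -> f y = 0] &
      \forall y \near x, f y = 1].
Proof.
move=> oU Ux; have [f [sf [C [cC CU f0]] f1]] := real_bump oU Ux.
exists (fun y => real_scalar (f y)); split.
- split; first by apply: (eq_smooth_real openT _ sf) => y _; rewrite re_real_scalar.
  by apply: (eq_smooth_real openT _ (smooth_real_cst _ 0)) => y _; rewrite im_real_scalar.
- by exists C; split=> // y nC; rewrite f0 // real_scalar0.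
- by apply: filterS f1 => y ->; rewrite real_scalar1.
Qed.

End Smooth.

(** * Extension and lifting of sections *)

Section Sections.
Variables (R : realType) (k : base_field) (M : manifold R).
Notation K := (base_scalar R k).
Implicit Types (U V : set M) (f g : M -> K) (E : vector_bundle k M).

(** [M] is the union of the open sets [U], where both factors are smooth, and the complement of [C],
    where the product is 0. *)
Lemma smooth_cutoff U C f g : open U -> closed C -> C `<=` U ->
  smooth setT f -> (forall y, ~ C y -> f y = 0) -> smooth U g ->
  smooth setT (fun y => f y * g y).
Proof.
move=> oU cC CU sf f0 sg; apply: smooth_local => x _.
have [Ux|nUx] := pselect (U x).
  by exists U; split=> //; apply: smoothM => //; apply: smooth_sub sf.
exists (~` C); split; [exact: closed_openC|by move=> /CU|].
by apply: (eq_smooth (closed_openC cC) _ (smooth_cst _ 0)) => y /f0->; rewrite mul0r.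
Qed.

Section Bundle.
Variable E : vector_bundle k M.
Implicit Types s t : forall x, E x.

Lemma smooth_section_sub U V s : V `<=` U -> smooth_section U s -> smooth_section V s.
Proof. by move=> VU sU i r; apply: smooth_sub (sU i r); apply: setIS. Qed.

Lemma smooth_section_local U s :
  (forall x, U x -> exists V, [/\ open V, V x & smooth_section V s]) ->
  smooth_section U s.
Proof.
move=> sU i r; apply: smooth_local => x [ix /sU[V [oV Vx sV]]].
by exists (@bdom _ _ _ E i `&` V); split=> //; apply: openI => //; apply: bdom_open.
Qed.

Lemma eq_smooth_section U s t : open U -> (forall x, U x -> s x = t x) ->
  smooth_section U s -> smooth_section U t.
Proof.
move=> oU st sU i r; apply: eq_smooth (sU i r).
  by apply: openI => //; apply: bdom_open.
by move=> x [_ /st->].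
Qed.

Lemma smooth_section0 U : smooth_section U (fun x => 0 : E x).
Proof.
move=> i r; apply: smooth_local => x [ix Ux].
exists (@bdom _ _ _ E i); split=> //; first exact: bdom_open.
by apply: (eq_smooth (bdom_open i) _ (smooth_cst _ 0)) => y _; rewrite linear0.
Qed.

Lemma smooth_sectionP U f s t : open U -> smooth U f ->
  smooth_section U s -> smooth_section U t ->
  smooth_section U (fun x => f x *: s x + t x).
Proof.
move=> oU sf ss st i r; have oI := openI (@bdom_open _ _ _ E i) oU.
have sf' : smooth (@bdom _ _ _ E i `&` U) f by apply: smooth_sub sf => ? [].
apply: (eq_smooth oI _ (smoothD oI (smoothM oI sf' (ss i r)) (st i r))) => x _.
by rewrite linearP.
Qed.

Lemma smooth_sectionZ U f s : open U -> smooth U f ->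
  smooth_section U s -> smooth_section U (fun x => f x *: s x).
Proof.
move=> oU sf ss; have := smooth_sectionP oU sf ss (smooth_section0 U).
by apply: eq_smooth_section => // x _; rewrite addr0.
Qed.

Lemma smooth_sectionD U s t : open U ->
  smooth_section U s -> smooth_section U t -> smooth_section U (fun x => s x + t x).
Proof.
move=> oU ss st; have := smooth_sectionP oU (smooth_cst U 1) ss st.
by apply: eq_smooth_section => // x _; rewrite scale1r.
Qed.

Lemma smooth_sectionN U s : open U ->
  smooth_section U s -> smooth_section U (fun x => - s x).
Proof.
move=> oU ss; have := smooth_sectionZ oU (smooth_cst U (-1)) ss.
by apply: eq_smooth_section => // x _; rewrite scaleN1r.
Qed.

Lemma smooth_sectionB U s t : open U ->
  smooth_section U s -> smooth_section U t -> smooth_section U (fun x => s x - t x).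
Proof. by move=> oU ss st; apply: smooth_sectionD => //; apply: smooth_sectionN. Qed.

Lemma smooth_section_sum (I : Type) (r : seq I) U (s : I -> forall x, E x) : open U ->
  (forall i, smooth_section U (s i)) ->
  smooth_section U (fun x => \sum_(i <- r) s i x).
Proof.
move=> oU ss; elim: r => [|i r IH].
  by apply: eq_smooth_section (smooth_section0 U) => // x _; rewrite big_nil.
by apply: eq_smooth_section (smooth_sectionD oU (ss i) IH) => // x _; rewrite big_cons.
Qed.

Lemma smooth_frame i j :
  smooth_section (@bdom _ _ _ E i) (fun x => tnth (@bframe _ _ _ E i x) j).
Proof. by move=> i' r; apply: btransition. Qed.

Lemma smooth_section_cutoff U C f s : open U -> closed C -> C `<=` U ->
  smooth setT f -> (forall y, ~ C y -> f y = 0) -> smooth_section U s ->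
  smooth_section setT (fun y => f y *: s y).
Proof.
move=> oU cC CU sf f0 ss; apply: smooth_section_local => x _.
have [Ux|nUx] := pselect (U x).
  by exists U; split=> //; apply: smooth_sectionZ => //; apply: smooth_sub sf.
exists (~` C); split; [exact: closed_openC|by move=> /CU|].
apply: (eq_smooth_section (closed_openC cC) _ (smooth_section0 _)) => y /f0->.
by rewrite scale0r.
Qed.

Lemma section_extend U x s : open U -> U x -> smooth_section U s ->
  exists2 t, smooth_section setT t & \forall y \near x, t y = s y.
Proof.
move=> oU Ux ss; have [f [sf [C [cC CU f0]] f1]] := bump k oU Ux.
exists (fun y => f y *: s y); first exact: smooth_section_cutoff f0 ss.
by apply: filterS f1 => y ->; rewrite scale1r.
Qed.

Lemma frame_coordE i x (v : E x) : @bdom _ _ _ E i x ->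
  v = \sum_r coord (bframe i x) r v *: tnth (bframe i x) r.
Proof.
move=> ix; rewrite {1}(coord_basis (bframe_basis ix) (memvf v)).
by apply: eq_bigr => r _; rewrite (tnth_nth 0).
Qed.

Lemma vector_extend x (v : E x) : exists2 t, smooth_section setT t & t x = v.
Proof.
have [i ix] := @bdom_cover _ _ _ E x.
pose s y := \sum_r coord (bframe i x) r v *: tnth (@bframe _ _ _ E i y) r.
have ss : smooth_section (@bdom _ _ _ E i) s.
  apply: smooth_section_sum => [|r]; first exact: bdom_open.
  by apply: smooth_sectionZ; [exact: bdom_open|exact: smooth_cst|exact: smooth_frame].
have [t st tE] := section_extend (bdom_open i) ix ss.
by exists t => //; rewrite (nbhs_singleton tE) /s -frame_coordE.
Qed.

Definition tensorial (x : M) (F : (forall y, E y) -> K) : Prop :=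
  forall f s t, smooth setT f -> smooth_section setT s -> smooth_section setT t ->
  F (fun y => f y *: s y + t y) = f x * F s + F t.

(** Let [f] be a bump supported in a frame domain around [x]. Then
    [s = (1 - f^2) s + sum_r (f s_r) (f e_r)], where one factor [f] makes the coefficients global
    and the other makes the frame global. At [x] all coefficients vanish, since [f x = 1] and
    [s x = 0]. *)
Lemma tensorial_eq0 x F s : tensorial x F -> smooth_section setT s ->
  s x = 0 -> F s = 0.
Proof.
move=> FT ss sx0; have [i ix] := @bdom_cover _ _ _ E x.
have oi := @bdom_open _ _ _ E i.
have [f [sf [C [cC CU f0]] f1]] := bump k oi ix.
pose e r y := f y *: tnth (@bframe _ _ _ E i y) r.
pose c r y := f y * coord (bframe i y) r (s y).
have se r : smooth_section setT (e r).
  by apply: (smooth_section_cutoff oi cC) => //; apply: smooth_frame.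
have sc r : smooth setT (c r).
  apply: (smooth_cutoff oi cC) => //; have := ss i r.
  by rewrite setIT.
have F0 : F (fun=> 0) = 0.
  have := FT _ _ _ (smooth_cst setT 1) (smooth_section0 setT) (smooth_section0 setT).
  rewrite (_ : (fun y => 1 *: 0 + 0 : E y) = (fun y => 0 : E y)).
    by move=> /esym/eqP; rewrite mul1r -subr_eq0 addrK => /eqP.
  by apply: functional_extensionality_dep => y; rewrite scaler0 addr0.
have Fsum (l : seq 'I_(brank E)) : F (fun y => \sum_(r <- l) c r y *: e r y) = 0.
  elim: l => [|r l IH].
    rewrite (_ : (fun y => _) = (fun y => 0 : E y)) //.
    by apply: functional_extensionality_dep => y; rewrite big_nil.
  rewrite (_ : (fun y => _) = (fun y => c r y *: e r y + \sum_(r <- l) c r y *: e r y)).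
    rewrite FT //; first by rewrite IH /c sx0 linear0 mulr0 mul0r addr0.
    apply: smooth_section_sum => [|r']; first exact: openT.
    by apply: smooth_sectionZ => //; exact: openT.
  by apply: functional_extensionality_dep => y; rewrite big_cons.
rewrite (_ : s = (fun y => (1 - f y * f y) *: s y + \sum_r c r y *: e r y)).
  rewrite FT //.
  - by rewrite Fsum (nbhs_singleton f1) mulr1 subrr mul0r addr0.
  - apply: smoothB; [exact: openT|exact: smooth_cst|exact: smoothM openT _ _].
  - apply: smooth_section_sum => [|r']; first exact: openT.
    by apply: smooth_sectionZ => //; exact: openT.
apply: functional_extensionality_dep => y; have [iy|niy] := pselect (@bdom _ _ _ E i y).
  rewrite (_ : \sum_r _ = (f y * f y) *: s y); first by rewrite -scalerDl subrK scale1r.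
  rewrite [in RHS](frame_coordE (s y) iy) scaler_sumr; apply: eq_bigr => r _.
  by rewrite /c /e !scalerA; congr (_ *: _); ring.
rewrite big1 => [|r _]; first by rewrite f0 ?mul0r ?subr0 ?scale1r ?addr0 // => /CU.
by rewrite /c f0 ?mul0r ?scale0r // => /CU.
Qed.

Lemma tensorialB x F s t : tensorial x F -> smooth_section setT s ->
  smooth_section setT t -> F (fun y => s y - t y) = F s - F t.
Proof.
move=> FT ss st; have := FT _ _ _ (smooth_cst setT (-1)) st ss.
rewrite (_ : (fun y => _) = (fun y => s y - t y)); first by move->; rewrite mulN1r addrC.
by apply: functional_extensionality_dep => y; rewrite scaleN1r addrC.
Qed.

Lemma tensorial_eq x F s t : tensorial x F -> smooth_section setT s ->
  smooth_section setT t -> s x = t x -> F s = F t.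
Proof.
move=> FT ss st sx; apply/eqP; rewrite -subr_eq0 -(tensorialB FT) //; apply/eqP.
by apply: (tensorial_eq0 FT); [exact: smooth_sectionB openT ss st|rewrite sx subrr].
Qed.

End Bundle.
End Sections.

(** * Sections of [A], and lifts from [L/A] to [L] *)

Section PairSections.
Variables (R : realType) (k : base_field) (M : manifold R) (P : lie_pair k M).
Notation K := (base_scalar R k).
Notation L := (ambient P).
Notation Q := (quot_bundle P).
Notation Asec := (forall x, subvs_of (subalgebroid P x)).
Notation Lsec := (forall x, L x).
Notation Qsec := (forall x, Q x).
Implicit Types (U V : set M) (f g : M -> K) (a b : Asec) (l m : Lsec) (q : Qsec).

Lemma bar_smooth U l : open U -> smooth_section U l -> smooth_section U (bar l).
Proof. exact: quot_map_smooth. Qed.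

Lemma bar_incl a x : bar (incl_sub a) x = 0.
Proof.
by apply/eqP; rewrite -memv_ker quot_map_kernel; apply: subvsP.
Qed.

Lemma sub_section_of l : (forall x, l x \in subalgebroid P x) ->
  incl_sub (fun x => vsproj (subalgebroid P x) (l x)) = l.
Proof.
by move=> lA; apply: functional_extensionality_dep => x; apply: vsprojK.
Qed.

Lemma incl_bracketA a b : smooth_subsection setT a -> smooth_subsection setT b ->
  incl_sub (bracketA a b) = bracket (incl_sub a) (incl_sub b).
Proof.
move=> sa sb; apply: sub_section_of => x.
by apply: sub_bracket => // y; apply: subvsP.
Qed.

Lemma subsection_extend U x a : open U -> U x -> smooth_subsection U a ->
  exists2 b, smooth_subsection setT b & \forall y \near x, b y = a y.
Proof.
move=> oU Ux sa; have [f [sf [C [cC CU f0]] f1]] := bump k oU Ux.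
exists (fun y => f y *: a y).
  have := smooth_section_cutoff oU cC CU sf f0 sa.
  apply: eq_smooth_section; first exact: openT.
  by move=> y _; rewrite /incl_sub linearZ.
by apply: filterS f1 => y ->; rewrite scale1r.
Qed.

(** Keep the coefficients of [v] constant in a local frame of [A] and cut off: the result stays in
    [A] on [U] by the choice of the frame, and off [U] because it is 0. *)
Lemma subvector_extend x (v : subvs_of (subalgebroid P x)) :
  exists2 a, smooth_subsection setT a & a x = v.
Proof.
have [r /(_ x)[U [e [oU Ux se eb]]]] := sub_subbundle P.
have [f [sf [C [cC CU f0]] f1]] := bump k oU Ux.
pose l y := f y *: \sum_j coord (e x) j (vsval v) *: tnth (e y) j.
have lA y : l y \in subalgebroid P y.
  have [Uy|nUy] := pselect (U y); last by rewrite /l f0 ?scale0r ?mem0v // => /CU.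
  apply: memvZ; apply: memv_suml => j _; apply: memvZ.
  by rewrite -(span_basis (eb y Uy)) memv_span // mem_tnth.
exists (fun y => vsproj (subalgebroid P y) (l y)).
  rewrite /smooth_subsection sub_section_of //.
  refine (smooth_section_cutoff oU cC CU sf f0 _).
  by apply: smooth_section_sum => // j; apply: smooth_sectionZ (se j) => //; exact: smooth_cst.
apply: val_inj; rewrite /= (vsprojK (lA x)) /l (nbhs_singleton f1) scale1r.
rewrite {2}(coord_basis (eb x Ux) (subvsP v)).
by apply: eq_bigr => j _; rewrite (tnth_nth 0).
Qed.

Lemma quot_vector_lift x (u : Q x) : exists2 l, smooth_section setT l & bar l x = u.
Proof.
have : u \in limg (quot_map P x) by rewrite quot_map_surjective memvf.
move=> /memv_imgP[v _ ->]; have [l sl lx] := vector_extend v.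
by exists l => //; rewrite /bar lx.
Qed.

(* Lifts of a frame of [L/A] at [x] remain independent near [x]; Cramer's rule
   gives smooth coefficients. *)
Lemma quot_section_lift U x q : open U -> U x -> smooth_section U q ->
  exists2 l, smooth_section setT l & \forall y \near x, bar l y = q y.
Proof.
move=> oU Ux sq; have [i ix] := @bdom_cover _ _ _ Q x.
have oi := @bdom_open _ _ _ Q i.
have [e eP] : {e : 'I_(brank Q) -> Lsec & forall r,
    smooth_section setT (e r) /\ bar (e r) x = tnth (bframe i x) r}.
  apply: (@choice _ _ (fun r (l : Lsec) => smooth_section setT l /\
    bar l x = tnth (bframe i x) r)) => r.
  by have [l sl lx] := quot_vector_lift (tnth (bframe i x) r); exists l.
pose G y : 'M[K]_(brank Q) := \matrix_(s, r) coord (bframe i y) s (bar (e r) y).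
have sG s r : smooth (@bdom _ _ _ Q i) (fun y => G y s r).
  have := bar_smooth openT (eP r).1; move=> /(_ i s); rewrite setIT.
  by apply: eq_smooth => // y _; rewrite mxE.
have Gx : \det (G x) = 1.
  rewrite (_ : G x = 1%:M) ?det1 //; apply/matrixP => s r; rewrite !mxE.
  by rewrite (eP r).2 (tnth_nth 0) coord_free 1?eq_sym ?(basis_free (bframe_basis ix)).
have sdet := smooth_det oi sG.
have dn0 : \forall y \near x, \det (G y) != 0.
  by apply: smooth_neq0_near sdet _ => //; rewrite Gx oner_eq0.
pose W := interior [set y | \det (G y) != 0] `&` (@bdom _ _ _ Q i `&` U).
have oW : open W by apply: openI; [exact: open_interior|exact: openI].
have Wx : W x by split=> //; exact: nbhs_interior.
have WU : W `<=` U by move=> y [_ []].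
have Wi : W `<=` @bdom _ _ _ Q i by move=> y [_ []].
have Wd y : W y -> \det (G y) != 0 by case=> /interior_subset.
pose h r y := (\det (G y))^-1 *
  \sum_s \adj (G y) r s * coord (bframe i y) s (q y).
have sh r : smooth W (h r).
  apply: smoothM => //; first by apply: smoothV => //; apply: smooth_sub sdet.
  apply: smooth_sum => // s; apply: smoothM => //.
    apply: (@smooth_sub _ _ _ (@bdom _ _ _ Q i)) => //.
    by apply: (eq_smooth oi _ (smooth_cofactor s r oi sG)) => y _; rewrite mxE.
  by apply: smooth_sub (sq i s) => y Wy; split; [exact: Wi|exact: WU].
have [l sl lW] : exists2 l, smooth_section setT l &
    \forall y \near x, l y = \sum_r h r y *: e r y.
  apply: (section_extend (s := fun y => \sum_r h r y *: e r y) oW Wx).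
  apply: smooth_section_sum => // r; apply: smooth_sectionZ => //.
  by apply: smooth_section_sub (eP r).1.
exists l => //; apply: filterS2 lW (open_nbhs_nbhs (conj oW Wx)) => y ly Wy.
rewrite /bar ly linear_sum (frame_coordE (q y) (Wi y Wy)).
have eE r : bar (e r) y = \sum_s G y s r *: tnth (bframe i y) s.
  by rewrite {1}(frame_coordE (bar (e r) y) (Wi y Wy)); apply: eq_bigr => s _; rewrite mxE.
transitivity (\sum_r \sum_s (h r y * G y s r) *: tnth (bframe i y) s).
  apply: eq_bigr => r _; rewrite linearZ -[X in _ *: X = _]/(bar (e r) y) eE scaler_sumr.
  by apply: eq_bigr => s _; rewrite scalerA.
rewrite exchange_big; apply: eq_bigr => s _ /=.
rewrite -scaler_suml; congr (_ *: _).
transitivity ((G y *m \col_r h r y) s 0).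
  by rewrite mxE; apply: eq_bigr => r _; rewrite !mxE mulrC.
rewrite (_ : \col_r h r y =
    (\det (G y))^-1 *: (\adj (G y) *m \col_s coord (bframe i y) s (q y))).
  rewrite -scalemxAr mulmxA mul_mx_adj mul_scalar_mx scalerA mulVf ?Wd //.
  by rewrite scale1r mxE.
apply/colP => r; rewrite !mxE /h; congr (_ * _).
by apply: eq_bigr => s' _; rewrite !mxE.
Qed.

End PairSections.

(** * Locality of anchors and connections *)

Section VectorCoordinates.
Variables (K : fieldType) (V : vectType K).

Definition vcoord (i : 'I_(\dim (fullv : {vspace V}))) (v : V) : K := coord (vbasis fullv) i v.

Lemma vcoord_inj (u v : V) : (forall i, vcoord i u = vcoord i v) -> u = v.
Proof.
move=> uv; rewrite (coord_vbasis (memvf u)) (coord_vbasis (memvf v)).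
by apply: eq_bigr => i _; rewrite -[coord _ _ u]/(vcoord i u) uv.
Qed.

Lemma vcoordD i u v : vcoord i (u + v) = vcoord i u + vcoord i v.
Proof. exact: linearD. Qed.

Lemma vcoordN i u : vcoord i (- u) = - vcoord i u.
Proof. exact: linearN. Qed.

Lemma vcoordZ i a u : vcoord i (a *: u) = a * vcoord i u.
Proof. exact: linearZ. Qed.

Lemma vcoord0 i : vcoord i 0 = 0.
Proof. exact: linear0. Qed.

End VectorCoordinates.

(* [ring] does not apply in a module, so compare coordinates. *)
Ltac vect := apply: vcoord_inj => ?;
  rewrite ?(vcoordD, vcoordN, vcoordZ, vcoord0); ring.

Section Locality.
Variables (R : realType) (k : base_field) (M : manifold R).
Notation K := (base_scalar R k).

(** The device behind locality. For [z = 0] one gets [s = f s] with [f x = 0] and [s x = 0], so both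
    terms of a Leibniz rule applied to [f s] vanish at [x]. The family [T] covers scalar functions
    as well as sections. *)
Lemma vanishing_near (x : M) (T : M -> Type) (z s : forall y, T y) :
  (\forall y \near x, s y = z y) -> exists f : M -> K,
  [/\ smooth setT f, f x = 0 & forall y, s y = z y \/ f y = 1].
Proof.
move=> sz; have [|f [sf [C [cC CU f0]] f1]] :=
  @bump R k M (interior [set y | s y = z y]) x (@open_interior _ _).
  exact: sz.
exists (fun y => 1 - f y); split.
- by apply: smoothB => //; [exact: openT|exact: smooth_cst].
- by rewrite (nbhs_singleton f1) subrr.
- move=> y; have [/CU/interior_subset|/f0->] := pselect (C y); first by left.
  by right; rewrite subr0.
Qed.

End Locality.

(** * Calculus of the anchor and the bracket *)

Section Algebroid.
Variables (R : realType) (k : base_field) (M : manifold R) (L : lie_algebroid k M).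
Notation K := (base_scalar R k).
Notation Lsec := (forall x, L x).
Implicit Types (f g : M -> K) (l m n : Lsec) (x : M).

Lemma anchor_funP x (v : L x) (c : K) f g : smooth setT f -> smooth setT g ->
  anchor v (fun y => c * f y + g y) = c * anchor v f + anchor v g.
Proof. by have [h _] := anchor_tangent v; apply: h. Qed.

Lemma anchor_funM x (v : L x) f g : smooth setT f -> smooth setT g ->
  anchor v (fun y => f y * g y) = anchor v f * g x + f x * anchor v g.
Proof. by have [_ h] := anchor_tangent v; apply: h. Qed.

Lemma anchor_funD x (v : L x) f g : smooth setT f -> smooth setT g ->
  anchor v (fun y => f y + g y) = anchor v f + anchor v g.
Proof.
move=> sf sg; rewrite -[in RHS](mul1r (anchor v f)) -anchor_funP //.
by congr anchor; apply/funext => y; rewrite mul1r.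
Qed.

Lemma anchor_fun0 x (v : L x) : anchor v (fun=> 0) = 0.
Proof.
have s0 := @smooth_cst R k M setT (0).
have := anchor_funD v s0 s0; rewrite (_ : (fun y => 0 + 0) = (fun=> 0) :> (M -> K)).
  by move=> /esym/eqP; rewrite -subr_eq0 addrK => /eqP.
by apply/funext => y; rewrite addr0.
Qed.

Lemma anchor_funZ x (v : L x) (c : K) f : smooth setT f ->
  anchor v (fun y => c * f y) = c * anchor v f.
Proof.
move=> sf; have := anchor_funP v c sf (@smooth_cst R k M setT (0)).
rewrite anchor_fun0 addr0 => <-.
by congr anchor; apply/funext => y; rewrite addr0.
Qed.

Lemma anchor_funN x (v : L x) f : smooth setT f ->
  anchor v (fun y => - f y) = - anchor v f.
Proof.
move=> sf; rewrite -mulN1r -anchor_funZ //.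
by congr anchor; apply/funext => y; rewrite mulN1r.
Qed.

Lemma anchor_funB x (v : L x) f g : smooth setT f -> smooth setT g ->
  anchor v (fun y => f y - g y) = anchor v f - anchor v g.
Proof.
move=> sf sg; rewrite anchor_funD ?anchor_funN //.
exact: smoothN openT sg.
Qed.

Lemma anchor0 x f : smooth setT f -> anchor (0 : L x) f = 0.
Proof.
move=> sf; have := anchor_linear 1 (0 : L x) 0 sf.
by rewrite scaler0 addr0 mul1r => /esym/eqP; rewrite -subr_eq0 addrK => /eqP.
Qed.

Lemma anchor_near x (v : L x) f g : smooth setT f -> smooth setT g ->
  (\forall y \near x, f y = g y) -> anchor v f = anchor v g.
Proof.
move=> sf sg fg; have sfg := smoothB openT sf sg.
have [|h [sh hx hP]] := @vanishing_near R k M x _ (fun=> 0) (fun y => f y - g y).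
  by apply: filterS fg => y ->; rewrite subrr.
apply/eqP; rewrite -subr_eq0 -anchor_funB //.
rewrite (_ : (fun y => f y - g y) = (fun y => h y * (f y - g y))).
  by rewrite anchor_funM // hx (nbhs_singleton fg) subrr mulr0 mul0r addr0.
by apply/funext => y; case: (hP y) => ->; rewrite ?mulr0 ?mul1r.
Qed.

Lemma bracketC l m : smooth_section setT l -> smooth_section setT m ->
  bracket l m = (fun x => - bracket m l x).
Proof. by move=> sl sm; apply: functional_extensionality_dep => x; rewrite bracket_antisym. Qed.

Lemma bracketZl f l m x : smooth setT f -> smooth_section setT l -> smooth_section setT m ->
  bracket (fun y => f y *: l y) m x = f x *: bracket l m x - anchor (m x) f *: l x.
Proof.
move=> sf sl sm; rewrite bracket_antisym //; last exact: smooth_sectionZ openT sf sl.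
by rewrite bracket_leibniz // (bracket_antisym sm sl) scalerN opprD opprK addrC.
Qed.

Lemma bracketDl l m n x : smooth_section setT l -> smooth_section setT m ->
  smooth_section setT n ->
  bracket (fun y => l y + m y) n x = bracket l n x + bracket m n x.
Proof.
move=> sl sm sn; rewrite -[in RHS](scale1r (bracket l n x)) -bracket_linear //.
by congr (bracket _ n x); apply: functional_extensionality_dep => y; rewrite scale1r.
Qed.

Lemma bracketDr l m n x : smooth_section setT l -> smooth_section setT m ->
  smooth_section setT n ->
  bracket n (fun y => l y + m y) x = bracket n l x + bracket n m x.
Proof.
move=> sl sm sn; rewrite bracket_antisym //; last exact: smooth_sectionD openT sl sm.
by rewrite bracketDl // opprD -!(bracket_antisym sn).
Qed.

Lemma anchor_cst x (v : L x) (c : K) : anchor v (fun=> c) = 0.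
Proof.
have s1 := @smooth_cst R k M setT (1).
have a1 : anchor v (fun=> 1) = 0.
  have := anchor_funM v s1 s1; rewrite (_ : (fun y => 1 * 1) = (fun=> 1) :> (M -> K)).
    by rewrite mulr1 mul1r => /esym/eqP; rewrite -subr_eq0 addrK => /eqP.
  by apply/funext => y; rewrite mulr1.
rewrite (_ : (fun=> c) = (fun y => c * (fun=> 1) y)); first by rewrite anchor_funZ // a1 mulr0.
by apply/funext => y; rewrite mulr1.
Qed.

Lemma bracketNr l m x : smooth_section setT l -> smooth_section setT m ->
  bracket l (fun y => - m y) x = - bracket l m x.
Proof.
move=> sl sm; have := bracket_leibniz sl sm (@smooth_cst R k M setT (-1)) x.
rewrite anchor_cst scale0r add0r scaleN1r => <-.
by congr (bracket l _ x); apply: functional_extensionality_dep => y; rewrite scaleN1r.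
Qed.

Lemma bracket_jacobiP l m n x : smooth_section setT l -> smooth_section setT m ->
  smooth_section setT n ->
  bracket (bracket l m) n x = bracket l (bracket m n) x - bracket m (bracket l n) x.
Proof.
move=> sl sm sn; have := bracket_jacobi sl sm sn x.
rewrite (bracketC sn sl) bracketNr //; last exact: bracket_smooth.
rewrite (bracket_antisym sn (bracket_smooth sl sm)).
by move/eqP; rewrite subr_eq0 => /eqP->.
Qed.

(* The Leibniz rule turns the Jacobi identity for [l, m, f n] into
   [(anchor [l, m] f - [anchor l, anchor m] f) n = 0]. *)
Lemma anchor_bracket l m f x : smooth_section setT l -> smooth_section setT m ->
  smooth setT f ->
  anchor (bracket l m x) f =
    anchor (l x) (fun y => anchor (m y) f) - anchor (m x) (fun y => anchor (l y) f).
Proof.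
move=> sl sm sf.
have slf : smooth setT (fun y => anchor (l y) f) by apply: anchor_smooth openT _ _.
have smf : smooth setT (fun y => anchor (m y) f) by apply: anchor_smooth openT _ _.
have key n : smooth_section setT n ->
    (anchor (l x) (fun y => anchor (m y) f) - anchor (m x) (fun y => anchor (l y) f)
      - anchor (bracket l m x) f) *: n x = 0.
  move=> sn; have slm := bracket_smooth sl sm.
  have sfn := smooth_sectionZ openT sf sn.
  have /eqP := bracket_jacobiP x sl sm sfn; rewrite eq_sym -subr_eq0 => /eqP.
  rewrite (bracket_leibniz slm sn sf).
  have E h : smooth_section setT h -> bracket h (fun y => f y *: n y) =
      (fun y => anchor (h y) f *: n y + f y *: bracket h n y).
    by move=> sh; apply: functional_extensionality_dep => y; rewrite bracket_leibniz.
  have sln := bracket_smooth sl sn; have smn := bracket_smooth sm sn.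
  rewrite (E m) // (E l) // !bracketDr //; try exact: smooth_sectionZ openT _ _.
  rewrite !bracket_leibniz // (bracket_jacobiP x sl sm sn).
  move=> h; rewrite -[RHS]h; vect.
(* A section not vanishing at [x] can be cancelled from [key]. If there is none, the fibre at [x] is
   0, hence by constancy of the rank all fibres are 0, and both sides vanish. *)
have [[n [sn nx]]|L0] := pselect (exists n : Lsec, smooth_section setT n /\ n x <> 0).
  have /eqP := key n sn; rewrite scaler_eq0 => /orP[/eqP/subr0_eq E0|/eqP//].
  by rewrite E0.
have Lx0 (v : L x) : v = 0.
  have [n sn <-] := vector_extend v.
  by apply: contrapT => nx; apply: L0; exists n.
have dimL y : \dim (fullv : {vspace L y}) = brank L.
  by have [i iy] := @bdom_cover _ _ _ L y; have /size_basis := bframe_basis iy.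
have Ly0 y (v : L y) : v = 0.
  have : \dim (fullv : {vspace L x}) = 0%N.
    apply/eqP; rewrite dimv_eq0; apply/eqP/vspaceP => u.
    by rewrite (Lx0 u) !mem0v.
  rewrite dimL -(dimL y) => /eqP; rewrite dimv_eq0 => /eqP d0.
  by apply/eqP; rewrite -memv0 -d0 memvf.
have a0 (l' : Lsec) : (fun y => anchor (l' y) f) = (fun=> 0).
  by apply/funext => y; rewrite (Ly0 y (l' y)) anchor0.
by rewrite !a0 !anchor_fun0 (Ly0 x (bracket l m x)) anchor0 // subrr.
Qed.

End Algebroid.

(** * Connections extending the action of [A], and invariance of [w] *)

Section PairGeometry.
Variables (R : realType) (k : base_field) (M : manifold R) (P : lie_pair k M).
Notation K := (base_scalar R k).
Notation L := (ambient P).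
Notation Q := (quot_bundle P).
Notation Asec := (forall x, subvs_of (subalgebroid P x)).
Notation Lsec := (forall x, L x).
Notation Qsec := (forall x, Q x).
Implicit Types (f g : M -> K) (a b : Asec) (l m : Lsec) (p q : Qsec) (x : M).
Variable D : Lsec -> Qsec -> Qsec.
Hypotheses (hD : connection D) (hA : extends_action D).

Lemma conn_smooth l q : smooth_section setT l -> smooth_section setT q ->
  smooth_section setT (D l q).
Proof. by have [h _ _ _] := hD; apply: h. Qed.

Lemma connP f l m q x : smooth setT f -> smooth_section setT l ->
  smooth_section setT m -> smooth_section setT q ->
  D (fun y => f y *: l y + m y) q x = f x *: D l q x + D m q x.
Proof. by have [_ h _ _] := hD => *; apply: h. Qed.

Lemma connD l p q x : smooth_section setT l -> smooth_section setT p ->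
  smooth_section setT q -> D l (fun y => p y + q y) x = D l p x + D l q x.
Proof. by have [_ _ h _] := hD => *; apply: h. Qed.

Lemma conn_leibniz f l q x : smooth setT f -> smooth_section setT l ->
  smooth_section setT q ->
  D l (fun y => f y *: q y) x = anchor (l x) f *: q x + f x *: D l q x.
Proof. by have [_ _ _ h] := hD => *; apply: h. Qed.

Lemma connN l q x : smooth_section setT l -> smooth_section setT q ->
  D l (fun y => - q y) x = - D l q x.
Proof.
move=> sl sq; have := conn_leibniz x (@smooth_cst R k M setT (-1)) sl sq.
rewrite anchor_cst scale0r add0r scaleN1r => <-.
by congr (D l _ x); apply: functional_extensionality_dep => y; rewrite scaleN1r.
Qed.

Lemma connB l p q x : smooth_section setT l -> smooth_section setT p ->
  smooth_section setT q -> D l (fun y => p y - q y) x = D l p x - D l q x.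
Proof. by move=> sl sp sq; rewrite connD ?connN //; exact: smooth_sectionN openT sq. Qed.

Lemma conn0 l x : smooth_section setT l -> D l (fun=> 0) x = 0.
Proof.
move=> sl; have s0 := @smooth_section0 R k M Q setT; have := connB x sl s0 s0.
rewrite subrr => h; rewrite -[RHS]h; congr (D l _ x).
by apply: functional_extensionality_dep => y; rewrite subrr.
Qed.

Lemma connDl l m q x : smooth_section setT l -> smooth_section setT m ->
  smooth_section setT q -> D (fun y => l y + m y) q x = D l q x + D m q x.
Proof.
move=> sl sm sq; have := connP x (@smooth_cst R k M setT 1) sl sm sq.
rewrite scale1r => <-; congr (D _ q x).
by apply: functional_extensionality_dep => y; rewrite scale1r.
Qed.

Lemma connNl l q x : smooth_section setT l -> smooth_section setT q ->
  D (fun y => - l y) q x = - D l q x.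
Proof.
move=> sl sq; have sN := smooth_sectionN openT sl; have := connDl x sl sN sq.
have -> : (fun y => l y - l y) = (fun y => 0 *: l y + 0).
  by apply: functional_extensionality_dep => y; rewrite subrr scale0r addr0.
have s0 := @smooth_section0 R k M L setT.
have D0 : D (fun y => 0) q x = 0.
  have := connDl x s0 s0 sq; rewrite (_ : (fun y => 0 + 0 : L y) = (fun y => 0)).
    by move=> /esym/eqP; rewrite -subr_eq0 addrK => /eqP.
  by apply: functional_extensionality_dep => y; rewrite addr0.
rewrite (connP x (@smooth_cst R k M setT 0) sl s0 sq) scale0r D0 add0r => /eqP.
by rewrite eq_sym addr_eq0 => /eqP->; rewrite opprK.
Qed.

Lemma connBl l m q x : smooth_section setT l -> smooth_section setT m ->
  smooth_section setT q -> D (fun y => l y - m y) q x = D l q x - D m q x.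
Proof. by move=> sl sm sq; rewrite connDl ?connNl //; exact: smooth_sectionN openT sm. Qed.

Lemma conn_near l p q x : smooth_section setT l -> smooth_section setT p ->
  smooth_section setT q -> (\forall y \near x, p y = q y) -> D l p x = D l q x.
Proof.
move=> sl sp sq pq; have spq := smooth_sectionB openT sp sq.
have [|h [sh hx hP]] := @vanishing_near R k M x _ (fun=> 0) (fun y => p y - q y).
  by apply: filterS pq => y ->; rewrite subrr.
apply/eqP; rewrite -subr_eq0 -connB //.
rewrite (_ : (fun y => p y - q y) = (fun y => h y *: (p y - q y))).
  by rewrite conn_leibniz // hx (nbhs_singleton pq) subrr scaler0 scale0r addr0.
by apply: functional_extensionality_dep => y; case: (hP y) => ->; rewrite ?scaler0 ?scale1r.
Qed.

Lemma barP f l m : bar (fun y => f y *: l y + m y) = (fun y => f y *: bar l y + bar m y).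
Proof. by apply: functional_extensionality_dep => x; rewrite /bar linearP. Qed.

Lemma barB l m x : bar (fun y => l y - m y) x = bar l x - bar m x.
Proof. by rewrite /bar linearB. Qed.

Lemma conn_action a l : smooth_subsection setT a -> smooth_section setT l ->
  D (incl_sub a) (bar l) = bar (bracket (incl_sub a) l).
Proof. by move=> sa sl; apply: functional_extensionality_dep => x; apply: hA. Qed.

(** [extends_action] speaks of sections of the form [bar l], whereas [q] is only lifted near [x];
    locality of [D] bridges the two. The equality is kept on a neighbourhood so that it can be
    differentiated again. *)
Lemma conn_action_near a l q x : smooth_subsection setT a -> smooth_section setT l ->
  smooth_section setT q -> (\forall y \near x, bar l y = q y) ->
  \forall y \near x, D (incl_sub a) q y = bar (bracket (incl_sub a) l) y.
Proof.
move=> sa sl sq /nbhs_interior; apply: filterS => y lq.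
rewrite -conn_action //; apply: conn_near => //; first exact: bar_smooth openT sl.
by apply: filterS lq => z ->.
Qed.

(** The curvature on all of [L]. [atiyah D a l] is convertible with [curv D (incl_sub a) l], so that
    its [A] slot can be treated as an [L] slot. *)
Definition curv (l m : Lsec) (q : Qsec) : Qsec :=
  fun x => D l (D m q) x - D m (D l q) x - D (bracket l m) q x.

Lemma curv_smooth l m q : smooth_section setT l -> smooth_section setT m ->
  smooth_section setT q -> smooth_section setT (curv l m q).
Proof.
move=> sl sm sq; have slm := bracket_smooth sl sm.
apply: smooth_sectionB; [exact: openT| |exact: conn_smooth].
exact: smooth_sectionB openT (conn_smooth sl (conn_smooth sm sq))
  (conn_smooth sm (conn_smooth sl sq)).
Qed.

Lemma curvC l m q x : smooth_section setT l -> smooth_section setT m ->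
  smooth_section setT q -> curv l m q x = - curv m l q x.
Proof.
move=> sl sm sq; rewrite /curv (bracketC sl sm) connNl //; last exact: bracket_smooth.
vect.
Qed.

(** Flatness of the action of [A]: after a local lift of [q], this is the projection of the Jacobi
    identity. *)
Lemma curv_sub a b q x : smooth_subsection setT a -> smooth_subsection setT b ->
  smooth_section setT q -> curv (incl_sub a) (incl_sub b) q x = 0.
Proof.
move=> sa sb sq; have [l sl lq] := quot_section_lift openT I sq (x := x).
have aE := conn_action_near sa sl sq lq; have bE := conn_action_near sb sl sq lq.
have sbl := bracket_smooth sb sl; have sal := bracket_smooth sa sl.
rewrite /curv (conn_near sa _ _ bE) ?(conn_near sb _ _ aE); try exact: conn_smooth;
  try exact: bar_smooth openT _.
have sab : smooth_subsection setT (bracketA a b).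
  by rewrite /smooth_subsection incl_bracketA //; exact: bracket_smooth.
rewrite !conn_action // -incl_bracketA //.
rewrite (nbhs_singleton (conn_action_near sab sl sq lq)) incl_bracketA // -!barB.
rewrite /bar bracket_jacobiP //.
by rewrite linearB subrr.
Qed.

Variable w : forall x, Q x -> Q x -> K.
Hypothesis hw : symplectic_form w.

Lemma form_smooth p q : smooth_section setT p -> smooth_section setT q ->
  smooth setT (fun x => w (p x) (q x)).
Proof. by have [[_ _ _ h] _ _] := hw; apply: h; exact: openT. Qed.

Lemma formPl x c (u v t : Q x) : w (c *: u + v) t = c * w u t + w v t.
Proof. by have [[h _ _ _] _ _] := hw. Qed.

Lemma formPr x c (u v t : Q x) : w t (c *: u + v) = c * w t u + w t v.
Proof. by have [[_ h _ _] _ _] := hw. Qed.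

Lemma form_diag x (u : Q x) : w u u = 0.
Proof. by have [[_ _ h _] _ _] := hw. Qed.

Lemma formDl x (u v t : Q x) : w (u + v) t = w u t + w v t.
Proof. by rewrite -[u]scale1r formPl scale1r mul1r. Qed.

Lemma formDr x (u v t : Q x) : w t (u + v) = w t u + w t v.
Proof. by rewrite -[u]scale1r formPr scale1r mul1r. Qed.

Lemma form0l x (t : Q x) : w 0 t = 0.
Proof. by have /eqP := formDl 0 0 t; rewrite addr0 eq_sym -subr_eq0 addrK => /eqP. Qed.

Lemma form0r x (t : Q x) : w t 0 = 0.
Proof. by have /eqP := formDr 0 0 t; rewrite addr0 eq_sym -subr_eq0 addrK => /eqP. Qed.

Lemma formZl x c (u t : Q x) : w (c *: u) t = c * w u t.
Proof. by rewrite -[c *: u]addr0 formPl form0l addr0. Qed.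

Lemma formZr x c (u t : Q x) : w t (c *: u) = c * w t u.
Proof. by rewrite -[c *: u]addr0 formPr form0r addr0. Qed.

Lemma formNl x (u t : Q x) : w (- u) t = - w u t.
Proof. by rewrite -scaleN1r formZl mulN1r. Qed.

Lemma formNr x (u t : Q x) : w t (- u) = - w t u.
Proof. by rewrite -scaleN1r formZr mulN1r. Qed.

Lemma formC x (u v : Q x) : w u v = - w v u.
Proof.
have := form_diag (u + v); rewrite formDl !formDr !form_diag add0r addr0 => /eqP.
by rewrite addr_eq0 => /eqP.
Qed.

Definition formE := (formDl, formDr, formNl, formNr, formZl, formZr, form0l, form0r).

(* Contracting [d_L (p^* w) = 0] with a section of [A]. *)
Lemma form_invariant a p q x : smooth_subsection setT a ->
  smooth_section setT p -> smooth_section setT q ->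
  anchor (incl_sub a x) (fun y => w (p y) (q y)) =
    w (D (incl_sub a) p x) (q x) + w (p x) (D (incl_sub a) q x).
Proof.
move=> sa sp sq; have [l sl lp] := quot_section_lift openT I sp (x := x).
have [m sm mq] := quot_section_lift openT I sq (x := x).
have [sbl sbm] := (bar_smooth openT sl, bar_smooth openT sm).
rewrite (nbhs_singleton (conn_action_near sa sl sp lp)).
rewrite (nbhs_singleton (conn_action_near sa sm sq mq)).
rewrite -(nbhs_singleton lp) -(nbhs_singleton mq).
rewrite (@anchor_near _ _ _ _ x _ (fun y => w (p y) (q y)) (fun y => w (bar l y) (bar m y))).
- have [_ _ /(_ _ _ _ sa sl sm x)] := hw; rewrite /d_L2 /pullback2.
  have a0 y : quot_map P y (incl_sub a y) = 0 := bar_incl a y.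
  rewrite a0 form0r subr0.
  under [X in _ - anchor (l x) X]funext => y do rewrite a0 form0l.
  under [X in _ + anchor (m x) X]funext => y do rewrite a0 form0l.
  rewrite !anchor_fun0 subr0 addr0 => /eqP.
  rewrite -addrA addr_eq0 => /eqP->.
  by rewrite opprD opprK [w (bar l x) _]formC.
- exact: form_smooth.
- exact: form_smooth.
- by apply: filterS2 lp mq => y -> ->.
Qed.

End PairGeometry.

(** * Tensors on L/A and the Atiyah cocycle *)

Section Functionals.
Variables (R : realType) (k : base_field) (M : manifold R) (P : lie_pair k M).
Notation K := (base_scalar R k).
Notation L := (ambient P).
Notation Q := (quot_bundle P).
Notation Asec := (forall x, subvs_of (subalgebroid P x)).
Notation Lsec := (forall x, L x).
Notation Qsec := (forall x, Q x).
Notation cubic := (forall x, Q x -> Q x -> Q x -> K).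
Implicit Types (f g : M -> K) (a b : Asec) (l m : Lsec) (p q : Qsec) (x : M).

Lemma tensorialN (E : vector_bundle k M) x (F G : (forall y, E y) -> K) :
  tensorial x F -> (forall s, smooth_section setT s -> G s = - F s) -> tensorial x G.
Proof.
move=> FT GF f s t sf ss st; rewrite !GF //; last exact: smooth_sectionP openT sf ss st.
by rewrite FT // opprD mulrN.
Qed.

(** The conditions for [F] to factor through the fibre of [L/A] at [x], as for the basic forms of a
    foliation. *)
Definition basic x (F : Lsec -> K) : Prop :=
  tensorial x F /\ (forall a, smooth_subsection setT a -> F (incl_sub a) = 0).

Lemma basicN x (F G : Lsec -> K) : basic x F ->
  (forall l, smooth_section setT l -> G l = - F l) -> basic x G.
Proof.
move=> [FT F0] GF; split; first exact: tensorialN FT GF.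
by move=> a sa; rewrite GF // F0 // oppr0.
Qed.

(** The difference of [l] and [m] lies in [A] at [x]. A section of [A] with that value there is
    killed by [F], and tensoriality lets it replace the difference. *)
Lemma basic_eq x F l m : basic x F -> smooth_section setT l -> smooth_section setT m ->
  bar l x = bar m x -> F l = F m.
Proof.
move=> [FT F0] sl sm lm; apply/eqP; rewrite -subr_eq0 -(tensorialB FT) //; apply/eqP.
have dA : l x - m x \in subalgebroid P x.
  by rewrite -quot_map_kernel memv_ker linearB subr_eq0; apply/eqP.
have [a sa ax] := subvector_extend (vsproj (subalgebroid P x) (l x - m x)).
rewrite -(F0 a sa); apply: (tensorial_eq FT) => //; first exact: smooth_sectionB openT sl sm.
by rewrite /incl_sub ax (vsprojK dA).
Qed.

(* Functionals of three sections of [L] that descend to sections of the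
    third tensor power of the dual of [L/A]. *)
Definition cubic_functional (F : Lsec -> Lsec -> Lsec -> M -> K) : Prop :=
  [/\ forall l1 l2 l3, smooth_section setT l1 -> smooth_section setT l2 ->
        smooth_section setT l3 -> smooth setT (F l1 l2 l3),
      forall l2 l3 x, smooth_section setT l2 -> smooth_section setT l3 ->
        basic x (fun l => F l l2 l3 x),
      forall l1 l3 x, smooth_section setT l1 -> smooth_section setT l3 ->
        basic x (fun l => F l1 l l3 x) &
      forall l1 l2 x, smooth_section setT l1 -> smooth_section setT l2 ->
        basic x (fun l => F l1 l2 l x)].

(** An arbitrary choice, not smooth in [x] or [u]; it is used for the values of functionals that do
    not depend on it. *)
Definition lift x (u : Q x) : Lsec := s2val (cid2 (quot_vector_lift u)).

Lemma lift_smooth x (u : Q x) : smooth_section setT (lift u).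
Proof. exact: (s2valP (cid2 (quot_vector_lift u))). Qed.

Lemma bar_lift x (u : Q x) : bar (lift u) x = u.
Proof. exact: (s2valP' (cid2 (quot_vector_lift u))). Qed.

Lemma cubic_functionalP F : cubic_functional F -> exists2 n : cubic, cochain0 n &
  forall l1 l2 l3, smooth_section setT l1 -> smooth_section setT l2 ->
    smooth_section setT l3 -> eval3 n l1 l2 l3 = F l1 l2 l3.
Proof.
move=> [sF F1 F2 F3].
pose n : cubic := fun x u1 u2 u3 => F (lift u1) (lift u2) (lift u3) x.
have sl y (u : Q y) : smooth_section setT (lift u) by exact: lift_smooth.
have bl y (u : Q y) : bar (lift u) y = u by exact: bar_lift.
have nE x l1 l2 l3 : smooth_section setT l1 -> smooth_section setT l2 ->
    smooth_section setT l3 -> n x (bar l1 x) (bar l2 x) (bar l3 x) = F l1 l2 l3 x.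
  move=> s1 s2 s3; rewrite /n.
  rewrite (basic_eq (F1 _ _ x (sl _ (bar l2 x)) (sl _ (bar l3 x))) (sl _ _) s1 (bl _ _)).
  rewrite (basic_eq (F2 _ _ x s1 (sl _ (bar l3 x))) (sl _ _) s2 (bl _ _)).
  by rewrite (basic_eq (F3 _ _ x s1 s2) (sl _ _) s3 (bl _ _)).
have scst (c : K) := @smooth_cst R k M setT c.
have linE x (c : K) (u v : Q x) : c *: u + v = bar (fun y => c *: lift u y + lift v y) x.
  by rewrite (barP (fun=> c)) !bl.
have slin x (c : K) (u v : Q x) : smooth_section setT (fun y => c *: lift u y + lift v y).
  exact: (smooth_sectionP openT (scst c) (sl x u) (sl x v)).
exists n; last by move=> *; apply/funext => x; apply: nE.
split=> [x|U b1 b2 b3 oU s1 s2 s3].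
  split=> c u v y z; rewrite linE -[in LHS](bl _ y) -[in LHS](bl _ z) nE //.
  - by have [FT _] := F1 _ _ x (sl _ y) (sl _ z); rewrite FT.
  - by have [FT _] := F2 _ _ x (sl _ y) (sl _ z); rewrite FT.
  - by have [FT _] := F3 _ _ x (sl _ y) (sl _ z); rewrite FT.
(* The fibrewise choices in [n] say nothing about smoothness. Near [x] they are replaced by three
   fixed lifts of [b1], [b2], [b3], for which [n] is the smooth function [F l1 l2 l3]. *)
apply: smooth_near => x Ux.
have [l1 sl1 e1] := quot_section_lift oU Ux s1.
have [l2 sl2 e2] := quot_section_lift oU Ux s2.
have [l3 sl3 e3] := quot_section_lift oU Ux s3.
exists (F l1 l2 l3); first exact: sF.
apply: filterS3 e1 e2 e3 => y <- <- <-; exact: nE.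
Qed.

End Functionals.

(** * Torsion, covariant derivative of [w], curvature, and their Lie derivatives along [A] *)

Section Cocycles.
Variables (R : realType) (k : base_field) (M : manifold R) (P : lie_pair k M).
Notation K := (base_scalar R k).
Notation L := (ambient P).
Notation Q := (quot_bundle P).
Notation Asec := (forall x, subvs_of (subalgebroid P x)).
Notation Lsec := (forall x, L x).
Notation Qsec := (forall x, Q x).
Notation cubic := (forall x, Q x -> Q x -> Q x -> K).
Notation Acubic :=
  (forall x, subvs_of (subalgebroid P x) -> Q x -> Q x -> Q x -> K).
Implicit Types (f g : M -> K) (a b : Asec) (l m n : Lsec) (p q : Qsec) (x : M).
Variables (D : Lsec -> Qsec -> Qsec) (w : forall x, Q x -> Q x -> K).
Hypotheses (hD : connection D) (hA : extends_action D) (hw : symplectic_form w).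

Let sD := conn_smooth hD.

Let sbar l : smooth_section setT l -> smooth_section setT (bar l).
Proof. exact: bar_smooth openT. Qed.

Let sbr l m : smooth_section setT l -> smooth_section setT m ->
  smooth_section setT (bracket l m).
Proof. exact: bracket_smooth. Qed.

Lemma torsion_smooth l m : smooth_section setT l -> smooth_section setT m ->
  smooth_section setT (torsion D l m).
Proof.
move=> sl sm.
apply: smooth_sectionB openT _ (sbar (sbr sl sm)).
exact: smooth_sectionB openT (sD sl (sbar sm)) (sD sm (sbar sl)).
Qed.

Let sR := curv_smooth hD.

Ltac smooth_sec := solve [repeat first
  [assumption | apply: sbar | apply: sbr | apply: sD | apply: torsion_smooth | apply: sR]].
#[local] Hint Extern 0 (smooth_section _ _) => smooth_sec : core.

Lemma bar_incl0 a : bar (incl_sub a) = (fun x => 0).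
Proof. by apply: functional_extensionality_dep => x; apply: bar_incl. Qed.

Lemma conn_leibnizP f l p q x : smooth setT f -> smooth_section setT l ->
  smooth_section setT p -> smooth_section setT q ->
  D l (fun y => f y *: p y + q y) x =
    anchor (l x) f *: p x + f x *: D l p x + D l q x.
Proof.
by move=> sf sl sp sq; rewrite (connD hD) ?(conn_leibniz hD) //; exact: smooth_sectionZ openT sf sp.
Qed.

Lemma bracketPl f l m n x : smooth setT f -> smooth_section setT l ->
  smooth_section setT m -> smooth_section setT n ->
  bracket (fun y => f y *: l y + m y) n x =
    f x *: bracket l n x + (- anchor (n x) f *: l x + bracket m n x).
Proof.
move=> sf sl sm sn; rewrite bracketDl ?bracketZl //; first by vect.
exact: smooth_sectionZ openT sf sl.
Qed.

Lemma torsionC l m x : smooth_section setT l -> smooth_section setT m ->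
  torsion D l m x = - torsion D m l x.
Proof.
by move=> sl sm; rewrite /torsion /bar (bracket_antisym sl sm) linearN; vect.
Qed.

Lemma torsionP f l m n x : smooth setT f -> smooth_section setT l ->
  smooth_section setT m -> smooth_section setT n ->
  torsion D (fun y => f y *: l y + m y) n x = f x *: torsion D l n x + torsion D m n x.
Proof.
move=> sf sl sm sn; rewrite /torsion (connP hD) // barP conn_leibnizP //.
rewrite [bar (bracket _ _) x]/bar bracketPl // !linearP /bar.
by vect.
Qed.

Lemma torsion_sub a l x : smooth_subsection setT a -> smooth_section setT l ->
  torsion D (incl_sub a) l x = 0.
Proof.
move=> sa sl; rewrite /torsion (conn_action hA) // bar_incl0 (conn0 hD) //.
by rewrite subr0 subrr.
Qed.

(** The torsion kills [A] in its first slot because [D] extends the action; antisymmetry transports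
    this to the second slot. *)
Lemma torsion_functional :
  cubic_functional (fun l1 l2 l3 x => w (torsion D l1 l2 x) (bar l3 x)).
Proof.
have b1 l2 l3 x : smooth_section setT l2 -> smooth_section setT l3 ->
    basic x (fun l => w (torsion D l l2 x) (bar l3 x)).
  move=> s2 s3; split=> [f s t sf ss st|a sa]; first by rewrite torsionP // (formPl hw).
  by rewrite torsion_sub // (form0l hw).
split=> //.
- by move=> l1 l2 l3 s1 s2 s3; apply: (form_smooth hw); [exact: torsion_smooth|exact: sbar].
- move=> l1 l3 x s1 s3; apply: basicN (b1 l1 l3 x s1 s3) _ => l sl.
  by rewrite torsionC // (formNl hw).
- move=> l1 l2 x s1 s2; split=> [f s t sf ss st|a sa].
    by rewrite barP (formPr hw).
  by rewrite bar_incl (form0r hw).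
Qed.

Lemma nabla_formC l1 l2 l3 x : smooth_section setT l1 -> smooth_section setT l2 ->
  smooth_section setT l3 -> nabla_form D w l1 l2 l3 x = - nabla_form D w l1 l3 l2 x.
Proof.
move=> s1 s2 s3; rewrite /nabla_form.
have -> : (fun y => w (bar l2 y) (bar l3 y)) = (fun y => - w (bar l3 y) (bar l2 y)).
  by apply/funext => y; rewrite (formC hw).
rewrite anchor_funN; last exact: (form_smooth hw (sbar s3) (sbar s2)).
by rewrite (formC hw (D _ _ _)) (formC hw (bar l2 x)); ring.
Qed.

(** Vanishing on [A] in the first slot is exactly the invariance of [w], so closedness of [w] enters
    here. The third slot follows from the second by antisymmetry. *)
Lemma nabla_form_functional : cubic_functional (nabla_form D w).
Proof.
have b2 l1 l3 x : smooth_section setT l1 -> smooth_section setT l3 ->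
    basic x (fun l => nabla_form D w l1 l l3 x).
  move=> s1 s3; have sb3 := sbar s3; split=> [f s t sf ss st|a sa]; rewrite /nabla_form.
    have [sbs sbt] := (sbar ss, sbar st).
    have -> : (fun y => w (bar (fun z => f z *: s z + t z) y) (bar l3 y)) =
      (fun y => f y * w (bar s y) (bar l3 y) + w (bar t y) (bar l3 y)).
      by apply/funext => y; rewrite barP (formPl hw).
    have [fs ft] := (form_smooth hw sbs sb3, form_smooth hw sbt sb3).
    rewrite anchor_funD // ?anchor_funM //; last exact: smoothM openT sf fs.
    by rewrite barP conn_leibnizP // !(formE hw); ring.
  rewrite bar_incl0 (conn0 hD) //.
  rewrite (_ : (fun y => w 0 (bar l3 y)) = (fun=> 0)); last first.
    by apply/funext => y; rewrite (form0l hw).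
  by rewrite anchor_fun0 !(form0l hw) !subr0.
split=> //.
- move=> l1 l2 l3 s1 s2 s3; have [b s] := (sbar s2, sbar s3).
  apply: smoothB; [exact: openT| |exact: (form_smooth hw b (sD s1 s))].
  apply: smoothB; [exact: openT| |exact: (form_smooth hw (sD s1 b) s)].
  by apply: anchor_smooth s1 _; [exact: openT|exact: form_smooth].
- move=> l2 l3 x s2 s3; have [b s] := (sbar s2, sbar s3).
  have sw := form_smooth hw b s; split=> [f l m sf sl sm|a sa]; rewrite /nabla_form.
    by rewrite !(connP hD) // anchor_linear // !(formE hw); ring.
  by rewrite (form_invariant hD hA hw) //; ring.
- move=> l1 l2 x s1 s2; apply: basicN (b2 l1 l2 x s1 s2) _ => l sl.
  by rewrite nabla_formC.
Qed.

Lemma curvPl f l m n q x : smooth setT f -> smooth_section setT l ->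
  smooth_section setT m -> smooth_section setT n -> smooth_section setT q ->
  curv D (fun y => f y *: l y + m y) n q x = f x *: curv D l n q x + curv D m n q x.
Proof.
move=> sf sl sm sn sq; rewrite /curv (connP hD) //.
have -> : D (fun y => f y *: l y + m y) q = (fun y => f y *: D l q y + D m q y).
  by apply: functional_extensionality_dep => y; rewrite (connP hD).
rewrite conn_leibnizP //.
have -> : bracket (fun y => f y *: l y + m y) n = (fun y => f y *: bracket l n y +
    (- anchor (n y) f *: l y + bracket m n y)).
  by apply: functional_extensionality_dep => y; rewrite bracketPl.
have sg : smooth setT (fun y => - anchor (n y) f).
  by apply: smoothN; [exact: openT|apply: anchor_smooth openT _ _].
have sr := smooth_sectionP openT sg sl (sbr sm sn).
rewrite (connP hD) // (connP hD) //.
by vect.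
Qed.

(** The second derivatives of [f] form a commutator of anchors, which [anchor_bracket] cancels
    against the derivative along [bracket l m]. *)
Lemma curvPr f l m p q x : smooth setT f -> smooth_section setT l ->
  smooth_section setT m -> smooth_section setT p -> smooth_section setT q ->
  curv D l m (fun y => f y *: p y + q y) x = f x *: curv D l m p x + curv D l m q x.
Proof.
move=> sf sl sm sp sq.
have key (h h' : Lsec) : smooth_section setT h -> smooth_section setT h' ->
    D h (D h' (fun y => f y *: p y + q y)) x =
      anchor (h x) (fun y => anchor (h' y) f) *: p x + anchor (h' x) f *: D h p x +
      anchor (h x) f *: D h' p x + f x *: D h (D h' p) x + D h (D h' q) x.
  move=> sh sh'.
  have -> : D h' (fun y => f y *: p y + q y) =
      (fun y => anchor (h' y) f *: p y + (f y *: D h' p y + D h' q y)).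
    by apply: functional_extensionality_dep => y; rewrite conn_leibnizP // addrA.
  have sg : smooth setT (fun y => anchor (h' y) f) by apply: anchor_smooth openT _ _.
  have sr := smooth_sectionP openT sf (sD sh' sp) (sD sh' sq).
  by rewrite !conn_leibnizP //; vect.
rewrite /curv !key // conn_leibnizP // (anchor_bracket x sl sm sf).
by vect.
Qed.

(** Tensoriality in the slot that will carry the section of [A]: it makes the value at a vector of
    [A] independent of the extension chosen. *)
Lemma curv_form_tensorial l1 l2 l3 x : smooth_section setT l1 ->
  smooth_section setT l2 -> smooth_section setT l3 ->
  tensorial x (fun l => w (curv D l l1 (bar l2) x) (bar l3 x)).
Proof.
by move=> s1 s2 s3 f s t sf ss st; rewrite curvPl // (formPl hw).
Qed.

(** In the slot [l1], vanishing on [A] is the flatness of the action, and tensoriality comes from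
    [curv_form_tensorial] by antisymmetry of the curvature. *)
Lemma atiyah_functional a : smooth_subsection setT a ->
  cubic_functional (fun l1 l2 l3 x => w (atiyah D a l1 (bar l2) x) (bar l3 x)).
Proof.
move=> sa; split.
- move=> l1 l2 l3 s1 s2 s3; apply: (form_smooth hw); last exact: sbar.
  exact: (curv_smooth hD sa s1 (sbar s2)).
- move=> l2 l3 x s2 s3; split=> [|b sb]; last first.
    by rewrite [atiyah _ _ _ _ _](curv_sub hD hA) ?(form0l hw) //; exact: sbar.
  have := curv_form_tensorial x sa s2 s3.
  move=> /tensorialN; apply=> s ss.
  by rewrite [atiyah _ _ _ _ _](curvC hD) ?(formNl hw) //; exact: sbar.
- move=> l1 l3 x s1 s3; split=> [f s t sf ss st|b sb].
    by rewrite barP [atiyah _ _ _ _ _]curvPr // (formPl hw).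
  rewrite bar_incl0 (_ : atiyah _ _ _ _ _ = 0) ?(form0l hw) // /atiyah.
  have z h : smooth_section setT h -> D h (fun=> 0) = (fun=> 0).
    by move=> sh; apply: functional_extensionality_dep => y; rewrite (conn0 hD).
  by rewrite !z // !subr0.
- move=> l1 l2 x s1 s2; split=> [f s t sf ss st|b sb]; first by rewrite barP (formPr hw).
  by rewrite bar_incl (form0r hw).
Qed.

(** The formula of [actA], for functionals of sections of [L] that need not come from a tensor on
    [L/A]. *)
Definition lie_der a (F : Lsec -> Lsec -> Lsec -> M -> K) l1 l2 l3 x : K :=
  anchor (incl_sub a x) (F l1 l2 l3)
  - F (bracket (incl_sub a) l1) l2 l3 x
  - F l1 (bracket (incl_sub a) l2) l3 x
  - F l1 l2 (bracket (incl_sub a) l3) x.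

Definition torsion_form l1 l2 l3 x : K := w (torsion D l1 l2 x) (bar l3 x).

Definition atiyah_form a l1 l2 l3 x : K := w (atiyah D a l1 (bar l2) x) (bar l3 x).

(** The first Bianchi identity on [a, l1, l2]: the curvature term applied to [bar a] and the torsion
    terms containing [a] are 0. *)
Lemma torsion_lie_der a l1 l2 x : smooth_subsection setT a ->
  smooth_section setT l1 -> smooth_section setT l2 ->
  D (incl_sub a) (torsion D l1 l2) x - torsion D (bracket (incl_sub a) l1) l2 x
    - torsion D l1 (bracket (incl_sub a) l2) x
  = atiyah D a l1 (bar l2) x - atiyah D a l2 (bar l1) x.
Proof.
move=> sa s1 s2; rewrite /torsion /atiyah.
rewrite (connB hD x sa (smooth_sectionB openT (sD s1 (sbar s2)) (sD s2 (sbar s1)))) //.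
rewrite (connB hD) // !(conn_action hA) //.
have -> : bar (bracket (bracket (incl_sub a) l1) l2) x =
    bar (bracket (incl_sub a) (bracket l1 l2)) x - bar (bracket l1 (bracket (incl_sub a) l2)) x.
  by rewrite /bar bracket_jacobiP // linearB.
by vect.
Qed.

Lemma atiyah_form_swap12 a l1 l2 l3 x : smooth_subsection setT a ->
  smooth_section setT l1 -> smooth_section setT l2 -> smooth_section setT l3 ->
  atiyah_form a l1 l2 l3 x - atiyah_form a l2 l1 l3 x = lie_der a torsion_form l1 l2 l3 x.
Proof.
move=> sa s1 s2 s3; rewrite /lie_der (form_invariant hD hA hw) // (conn_action hA) //.
rewrite /atiyah_form /torsion_form -[X in X - _ = _]addr0.
have /(congr1 (fun u => w u (bar l3 x))) := torsion_lie_der x sa s1 s2.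
by rewrite !(formE hw) => h; rewrite addr0 -h; ring.
Qed.

(** By antisymmetry of [w], the left side is [w(R u, v) + w(u, R v)], which is minus the curvature
    applied to [w]. In that commutator of covariant derivatives the terms with [D_a w] vanish, and
    the derivative of [nabla w] along [a] remains. *)
Lemma atiyah_form_swap23 a l1 l2 l3 x : smooth_subsection setT a ->
  smooth_section setT l1 -> smooth_section setT l2 -> smooth_section setT l3 ->
  atiyah_form a l1 l2 l3 x - atiyah_form a l1 l3 l2 x =
    - lie_der a (nabla_form D w) l1 l2 l3 x.
Proof.
move=> sa s1 s2 s3; have sw := form_smooth hw.
have sw23 : smooth setT (fun y => w (bar l2 y) (bar l3 y)) by apply: sw.
have sw1 : smooth setT (fun y => anchor (l1 y) (fun z => w (bar l2 z) (bar l3 z))).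
  by apply: anchor_smooth openT _ _.
have swa : smooth setT (fun y => w (D l1 (bar l2) y) (bar l3 y)) by apply: sw.
have swb : smooth setT (fun y => w (bar l2 y) (D l1 (bar l3) y)) by apply: sw.
rewrite /lie_der /nabla_form.
rewrite (anchor_funB _ (smoothB openT sw1 swa) swb) (anchor_funB _ sw1 swa).
rewrite !(form_invariant hD hA hw) // (anchor_bracket x sa s1 sw23).
have -> : (fun y => anchor (incl_sub a y) (fun z => w (bar l2 z) (bar l3 z))) =
    (fun y => w (D (incl_sub a) (bar l2) y) (bar l3 y)
      + w (bar l2 y) (D (incl_sub a) (bar l3) y)).
  by apply/funext => y; rewrite (form_invariant hD hA hw).
rewrite anchor_funD; [|exact: sw|exact: sw].
rewrite -!(conn_action hA) // /atiyah_form /atiyah !(formE hw).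
rewrite (formC hw (D (incl_sub a) (D l1 (bar l3)) x)).
rewrite (formC hw (D l1 (D (incl_sub a) (bar l3)) x)).
rewrite (formC hw (D (bracket (incl_sub a) l1) (bar l3) x)).
ring.
Qed.

(** The second Bianchi identity on [a, b, l1]. Its terms with the curvature of the pair [a, b] are
    [flat1] and [flat2], both 0; the others are the differential. *)
Lemma atiyah_form_closed a b l1 l2 l3 x : smooth_subsection setT a ->
  smooth_subsection setT b ->
  smooth_section setT l1 -> smooth_section setT l2 -> smooth_section setT l3 ->
  lie_der a (atiyah_form b) l1 l2 l3 x - lie_der b (atiyah_form a) l1 l2 l3 x
    - atiyah_form (bracketA a b) l1 l2 l3 x = 0.
Proof.
move=> sa sb s1 s2 s3; set q := bar l2; have sq : smooth_section setT q by [].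
have E c d : smooth_subsection setT c -> smooth_subsection setT d ->
    lie_der c (atiyah_form d) l1 l2 l3 x =
    w (D (incl_sub c) (curv D (incl_sub d) l1 q) x
       - curv D (incl_sub d) (bracket (incl_sub c) l1) q x
       - curv D (incl_sub d) l1 (D (incl_sub c) q) x) (bar l3 x).
  move=> sc sd; rewrite /lie_der.
  have -> : atiyah_form d l1 l2 l3 = (fun y => w (curv D (incl_sub d) l1 q y) (bar l3 y)) by [].
  rewrite (form_invariant hD hA hw) // /atiyah_form -!(conn_action hA) // !(formE hw).
  rewrite /atiyah /curv; ring.
rewrite !E // /atiyah_form [atiyah _ _ _ _ _]/(curv D _ l1 q x) incl_bracketA //.
rewrite -!(formNl hw) -!(formDl hw).
set v := (X in w X _); suff -> : v = 0 by rewrite (form0l hw).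
have flat1 := curv_sub hD hA x sa sb (sD s1 sq).
have flat2 : D l1 (curv D (incl_sub a) (incl_sub b) q) x = 0.
  rewrite (_ : curv _ _ _ _ = (fun=> 0)) ?(conn0 hD) //.
  by apply: functional_extensionality_dep => y; rewrite (curv_sub hD hA).
have jac : D (bracket (bracket (incl_sub a) (incl_sub b)) l1) q x =
    D (bracket (incl_sub a) (bracket (incl_sub b) l1)) q x
    - D (bracket (incl_sub b) (bracket (incl_sub a) l1)) q x.
  rewrite -(connBl hD) //; congr (D _ q x).
  by apply: functional_extensionality_dep => y; rewrite bracket_jacobiP.
have Dcurv h l m : smooth_section setT h -> smooth_section setT l -> smooth_section setT m ->
    D h (curv D l m q) x = D h (D l (D m q)) x - D h (D m (D l q)) x - D h (D (bracket l m) q) x.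
  move=> sh sl sm; rewrite /curv.
  rewrite (connB hD x sh (smooth_sectionB openT (sD sl (sD sm sq)) (sD sm (sD sl sq)))) //.
  by rewrite (connB hD).
move: flat1 flat2; rewrite /v !Dcurv // /curv jac => flat1 flat2.
rewrite -[RHS]subr0 -{1}flat1 -flat2; vect.
Qed.

Lemma lie_der0 a (F : Lsec -> Lsec -> Lsec -> M -> K) l1 l2 l3 x :
  (forall m1 m2 m3, smooth_section setT m1 -> smooth_section setT m2 ->
     smooth_section setT m3 -> F m1 m2 m3 = (fun=> 0)) ->
  smooth_subsection setT a ->
  smooth_section setT l1 -> smooth_section setT l2 -> smooth_section setT l3 ->
  lie_der a F l1 l2 l3 x = 0.
Proof.
by move=> F0 sa s1 s2 s3; rewrite /lie_der !F0 // anchor_fun0 !subr0.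
Qed.

(** * Existence, uniqueness and closedness of the cochain, and its symmetry for symplectic
    connections *)

Definition sub_lift x (v : subvs_of (subalgebroid P x)) : {a : Asec | smooth_subsection setT a} :=
  exist _ (s2val (cid2 (subvector_extend v))) (s2valP (cid2 (subvector_extend v))).

Lemma sub_liftE x (v : subvs_of (subalgebroid P x)) : sval (sub_lift v) x = v.
Proof. exact: (s2valP' (cid2 (subvector_extend v))). Qed.

(** Descent in two stages: for each fixed [a] the three [L] slots descend to a cochain [n a], then
    [s] at a vector [v] of [A] uses an extension of [v]. Independence of this extension is [sE]. *)
Lemma tilde_atiyah_exists : exists s : Acubic, tilde_atiyah w D s.
Proof.
pose A := {a : Asec | smooth_subsection setT a}.
have [n nP] : {n : A -> cubic & forall i, cochain0 (n i) /\
    (forall l1 l2 l3, smooth_section setT l1 -> smooth_section setT l2 ->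
      smooth_section setT l3 -> eval3 (n i) l1 l2 l3 = atiyah_form (sval i) l1 l2 l3)}.
  apply: (@choice _ _ (fun (i : A) (n : cubic) => cochain0 n /\
    (forall l1 l2 l3, smooth_section setT l1 -> smooth_section setT l2 ->
      smooth_section setT l3 -> eval3 n l1 l2 l3 = atiyah_form (sval i) l1 l2 l3))) => -[a sa].
  by have [n cn nE] := cubic_functionalP (atiyah_functional sa); exists n.
have sl x (u : Q x) : smooth_section setT (lift u) by exact: lift_smooth.
have nE i x (u1 u2 u3 : Q x) :
    n i x u1 u2 u3 = atiyah_form (sval i) (lift u1) (lift u2) (lift u3) x.
  by rewrite -(nP i).2 // /eval3 !bar_lift.
pose s : Acubic := fun x v => n (sub_lift v) x.
have sE x (i : A) (u1 u2 u3 : Q x) : s x (sval i x) u1 u2 u3 = n i x u1 u2 u3.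
  rewrite /s !nE; apply: (tensorial_eq (curv_form_tensorial x (sl x u1) (sl x u2) (sl x u3))).
  - exact: (svalP (sub_lift _)).
  - exact: (svalP i).
  - by rewrite /incl_sub sub_liftE.
exists s; split; last first.
  move=> a l1 l2 l3 sa s1 s2 s3 x.
  rewrite -[a]/(sval (exist _ a sa : A)) sE.
  by have /(congr1 (fun h => h x)) := (nP (exist _ a sa)).2 l1 l2 l3 s1 s2 s3.
split=> [x c v v' u1 u2 u3|x v|U a b1 b2 b3 oU sa s1 s2 s3].
- have sv := svalP (sub_lift v); have sv' := svalP (sub_lift v').
  have sc := @smooth_cst R k M setT c.
  pose a0 : Asec := fun y => c *: sval (sub_lift v) y + sval (sub_lift v') y.
  have a0E : incl_sub a0 = (fun y =>
      c *: incl_sub (sval (sub_lift v)) y + incl_sub (sval (sub_lift v')) y).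
    by apply: functional_extensionality_dep => y; rewrite /incl_sub linearP.
  have sa0 : smooth_subsection setT a0.
    by rewrite /smooth_subsection a0E; apply: smooth_sectionP openT sc sv sv'.
  have -> : c *: v + v' = sval (exist _ a0 sa0 : A) x by rewrite /= /a0 !sub_liftE.
  rewrite sE /s !nE /=.
  rewrite -[LHS]/(w (curv D (incl_sub a0) _ _ x) _) a0E.
  exact: (curv_form_tensorial x (sl x u1) (sl x u2) (sl x u3) sc sv sv').
- by have [[h _] _] := nP (sub_lift v); apply: h.
(* The extension used by [s] varies from point to point. Near [x], a single global [a'] that agrees
   with [a] replaces it, by [sE]. *)
apply: smooth_local => x Ux; have [a' sa' aa'] := subsection_extend oU Ux sa.
exists (interior [set y | a' y = a y] `&` U); split.
- by apply: openI => //; exact: open_interior.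
- by split.
have oV : open (interior [set y | a' y = a y] `&` U) by apply: openI => //; exact: open_interior.
have [[_ sn] _] := nP (exist _ a' sa').
apply: (@eq_smooth _ _ _ _ (fun y => n (exist _ a' sa') y (b1 y) (b2 y) (b3 y))) => //.
  by move=> y [/interior_subset /= <- _]; rewrite -sE.
have VU : interior [set y | a' y = a y] `&` U `<=` U by move=> y [].
exact: sn oV (smooth_section_sub VU s1) (smooth_section_sub VU s2) (smooth_section_sub VU s3).
Qed.

Lemma tilde_atiyahE s a l1 l2 l3 : tilde_atiyah w D s -> smooth_subsection setT a ->
  smooth_section setT l1 -> smooth_section setT l2 -> smooth_section setT l3 ->
  eval3 (contract1 s a) l1 l2 l3 = atiyah_form a l1 l2 l3.
Proof. by move=> [_ sE] *; apply/funext => x; apply: sE. Qed.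

(** Every vector of [A] and of [L/A] is the value of a global smooth section, so cochains are
    determined by global sections. *)
Lemma section_ext3 (s t : Acubic) :
  (forall a l1 l2 l3, smooth_subsection setT a -> smooth_section setT l1 ->
     smooth_section setT l2 -> smooth_section setT l3 -> forall x,
     eval3 (contract1 s a) l1 l2 l3 x = eval3 (contract1 t a) l1 l2 l3 x) ->
  forall x v u1 u2 u3, s x v u1 u2 u3 = t x v u1 u2 u3.
Proof.
move=> st x v u1 u2 u3; rewrite -(sub_liftE v) -(bar_lift u1) -(bar_lift u2) -(bar_lift u3).
apply: st; try exact: lift_smooth; exact: (svalP (sub_lift _)).
Qed.

Lemma tilde_atiyah_unique (s t : Acubic) : tilde_atiyah w D s -> tilde_atiyah w D t -> s = t.
Proof.
move=> hs ht; do 5 (apply: functional_extensionality_dep => ?).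
by apply: section_ext3 => *; rewrite !tilde_atiyahE.
Qed.

Lemma tilde_atiyah_closed s : tilde_atiyah w D s -> closed1 s.
Proof.
move=> hs a b l1 l2 l3 sa sb s1 s2 s3 x.
have sab : smooth_subsection setT (bracketA a b).
  by rewrite /smooth_subsection incl_bracketA //; apply: bracket_smooth.
rewrite /d_A1 /actA !(tilde_atiyahE hs) //.
exact: atiyah_form_closed.
Qed.

Lemma tilde_atiyah_symplectic s : tilde_atiyah w D s -> symplectic_connection w D ->
  sym_cochain1 s.
Proof.
move=> hs [_ tor0 nab0]; split; first by case: hs.
move=> x v; split=> u1 u2 u3.
  apply: (@section_ext3 s (fun x v u1 u2 u3 => s x v u2 u1 u3)) => a l1 l2 l3 sa s1 s2 s3 y.
  transitivity (eval3 (contract1 s a) l2 l1 l3 y) => //; rewrite !(tilde_atiyahE hs) //.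
  apply/eqP; rewrite -subr_eq0 atiyah_form_swap12 // lie_der0 // => m1 m2 m3 sm1 sm2 sm3.
  by apply/funext => z; rewrite /torsion_form tor0 // (form0l hw).
apply: (@section_ext3 s (fun x v u1 u2 u3 => s x v u1 u3 u2)) => a l1 l2 l3 sa s1 s2 s3 y.
transitivity (eval3 (contract1 s a) l1 l3 l2 y) => //; rewrite !(tilde_atiyahE hs) //.
apply/eqP; rewrite -subr_eq0 atiyah_form_swap23 // lie_der0 ?oppr0 // => m1 m2 m3 sm1 sm2 sm3.
by apply/funext => z; rewrite nab0.
Qed.

(** * Symmetrization of the cocycle *)

Definition symmetrize (s : Acubic) : Acubic := fun x v u1 u2 u3 =>
  6%:R^-1 * (s x v u1 u2 u3 + s x v u2 u1 u3 + s x v u1 u3 u2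
             + s x v u2 u3 u1 + s x v u3 u1 u2 + s x v u3 u2 u1).

Lemma symmetrize_cochain s : cochain1 s -> sym_cochain1 (symmetrize s).
Proof.
move=> [s0 s123 sS]; split; last by move=> x v; split=> u1 u2 u3; rewrite /symmetrize; ring.
split=> [x c v v' u1 u2 u3|x v|U a b1 b2 b3 oU sa sb1 sb2 sb3].
- by rewrite /symmetrize !s0; ring.
- have [h1 h2 h3] := s123 x v.
  by split=> c u v' y z; rewrite /symmetrize !h1 !h2 !h3; ring.
apply: smoothM => //; first exact: smooth_cst.
by do 5 (apply: smoothD => //; last exact: sS); apply: sS.
Qed.

(** Shaped after the average over the six permutations of three slots. *)
Lemma anchor_fun6 x (v : L x) (c : K) (f1 f2 f3 f4 f5 f6 : M -> K) :
  smooth setT f1 -> smooth setT f2 -> smooth setT f3 ->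
  smooth setT f4 -> smooth setT f5 -> smooth setT f6 ->
  anchor v (fun y => c * (f1 y + f2 y + f3 y + f4 y + f5 y + f6 y)) =
  c * (anchor v f1 + anchor v f2 + anchor v f3 + anchor v f4 + anchor v f5 + anchor v f6).
Proof.
move=> s1 s2 s3 s4 s5 s6.
have s12 := smoothD openT s1 s2; have s13 := smoothD openT s12 s3.
have s14 := smoothD openT s13 s4; have s15 := smoothD openT s14 s5.
by rewrite anchor_funZ ?anchor_funD //; exact: smoothD openT s15 s6.
Qed.

Lemma eval3_smooth (n : cubic) l1 l2 l3 : cochain0 n -> smooth_section setT l1 ->
  smooth_section setT l2 -> smooth_section setT l3 -> smooth setT (eval3 n l1 l2 l3).
Proof. by move=> [_ sn] s1 s2 s3; apply: sn => //; exact: openT. Qed.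

Lemma contract1_cochain s a : cochain1 s -> smooth_subsection setT a ->
  forall l1 l2 l3, smooth_section setT l1 -> smooth_section setT l2 ->
  smooth_section setT l3 -> smooth setT (eval3 (contract1 s a) l1 l2 l3).
Proof.
move=> [_ _ sS] sa l1 l2 l3 s1 s2 s3.
by apply: (sS setT a (bar l1) (bar l2) (bar l3)) => //; exact: openT.
Qed.

(** The differential commutes with permutations of the three slots, hence with their average. *)
Lemma symmetrize_closed s : cochain1 s -> closed1 s -> closed1 (symmetrize s).
Proof.
move=> cs ds a b l1 l2 l3 sa sb s1 s2 s3 x.
have E c d m1 m2 m3 : smooth_subsection setT c -> smooth_subsection setT d ->
    smooth_section setT m1 -> smooth_section setT m2 -> smooth_section setT m3 ->
    actA c (contract1 (symmetrize s) d) m1 m2 m3 x =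
    6%:R^-1 * (actA c (contract1 s d) m1 m2 m3 x + actA c (contract1 s d) m2 m1 m3 x
      + actA c (contract1 s d) m1 m3 m2 x + actA c (contract1 s d) m2 m3 m1 x
      + actA c (contract1 s d) m3 m1 m2 x + actA c (contract1 s d) m3 m2 m1 x).
  move=> sc sd sm1 sm2 sm3; rewrite /actA.
  have sS := contract1_cochain cs sd.
  rewrite [X in anchor _ X](_ : _ = fun y => 6%:R^-1 *
    (eval3 (contract1 s d) m1 m2 m3 y + eval3 (contract1 s d) m2 m1 m3 y
     + eval3 (contract1 s d) m1 m3 m2 y + eval3 (contract1 s d) m2 m3 m1 y
     + eval3 (contract1 s d) m3 m1 m2 y + eval3 (contract1 s d) m3 m2 m1 y)) //.
  rewrite anchor_fun6; try exact: sS.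
  by rewrite /eval3 /contract1 /symmetrize; ring.
rewrite /d_A1 !E //.
have F : eval3 (contract1 (symmetrize s) (bracketA a b)) l1 l2 l3 x =
   6%:R^-1 * (eval3 (contract1 s (bracketA a b)) l1 l2 l3 x
     + eval3 (contract1 s (bracketA a b)) l2 l1 l3 x
     + eval3 (contract1 s (bracketA a b)) l1 l3 l2 x
     + eval3 (contract1 s (bracketA a b)) l2 l3 l1 x
     + eval3 (contract1 s (bracketA a b)) l3 l1 l2 x
     + eval3 (contract1 s (bracketA a b)) l3 l2 l1 x) by [].
rewrite F.
have d123 := ds a b l1 l2 l3 sa sb s1 s2 s3 x.
have d213 := ds a b l2 l1 l3 sa sb s2 s1 s3 x.
have d132 := ds a b l1 l3 l2 sa sb s1 s3 s2 x.
have d231 := ds a b l2 l3 l1 sa sb s2 s3 s1 x.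
have d312 := ds a b l3 l1 l2 sa sb s3 s1 s2 x.
have d321 := ds a b l3 l2 l1 sa sb s3 s2 s1 x.
transitivity (6%:R^-1 * (d_A1 s a b l1 l2 l3 x + d_A1 s a b l2 l1 l3 x + d_A1 s a b l1 l3 l2 x
  + d_A1 s a b l2 l3 l1 x + d_A1 s a b l3 l1 l2 x + d_A1 s a b l3 l2 l1 x)).
  by rewrite /d_A1; ring.
by rewrite d123 d213 d132 d231 d312 d321 !addr0 mulr0.
Qed.

(* [s - symmetrize s] is an average of the differences [s - s \o sigma]; write
   each permutation as a product of adjacent transpositions. *)
Lemma symmetrize_cohomologous s : tilde_atiyah w D s -> cohomologous s (symmetrize s).
Proof.
move=> hs.
have [T cT TE] : exists2 T : cubic, cochain0 T & forall l1 l2 l3,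
    smooth_section setT l1 -> smooth_section setT l2 -> smooth_section setT l3 ->
    eval3 T l1 l2 l3 = torsion_form l1 l2 l3.
  exact: cubic_functionalP torsion_functional.
have [C cC CE] := cubic_functionalP nabla_form_functional.
have [T3 sT3] := cT; have [C3 sC3] := cC.
(* The null last term puts [n] in the shape of [anchor_fun6]. *)
pose n : cubic := fun x u v z => 6%:R^-1 * (3%:R * T x u v z + - 2%:R * C x u v z
  + - 2%:R * C x v u z + 1 * T x u z v + 1 * T x v z u + 0 * T x u v z).
exists n.
  split=> [x|U b1 b2 b3 oU sb1 sb2 sb3].
    have [t1 t2 t3] := T3 x; have [c1 c2 c3] := C3 x.
    by split=> c u v y z; rewrite /n ?t1 ?t2 ?t3 ?c1 ?c2 ?c3; ring.
  apply: smoothM => //; first exact: smooth_cst.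
  have sm c f : smooth U f -> smooth U (fun x => c * f x).
    by move=> sf; apply: smoothM => //; exact: smooth_cst.
  by do 5 (apply: smoothD => //; last by apply: sm; first [exact: sT3|exact: sC3]);
    apply: sm; exact: sT3.
move=> a l1 l2 l3 sa s1 s2 s3 x.
have sT' m1 m2 m3 c : smooth_section setT m1 -> smooth_section setT m2 ->
    smooth_section setT m3 ->
    smooth setT (fun y => c * eval3 T m1 m2 m3 y).
  by move=> *; apply: smoothM openT (smooth_cst _ _) _; apply: eval3_smooth.
have sC' m1 m2 m3 c : smooth_section setT m1 -> smooth_section setT m2 ->
    smooth_section setT m3 ->
    smooth setT (fun y => c * eval3 C m1 m2 m3 y).
  by move=> *; apply: smoothM openT (smooth_cst _ _) _; apply: eval3_smooth.
(* The coefficients count paths in a tree of adjacent transpositions rooted at 123, with edges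
   123-213, 123-132, 213-231, 132-312 and 231-321. Each edge is weighted by the number of
   permutations reached through it: 3, 2, 2, 1, 1. Edges exchanging the first two slots contribute
   the torsion, the others minus [nabla w]. *)
have dn : d_A0 n a l1 l2 l3 x = 6%:R^-1 * (3%:R * lie_der a torsion_form l1 l2 l3 x
    - 2%:R * lie_der a (nabla_form D w) l1 l2 l3 x
    - 2%:R * lie_der a (nabla_form D w) l2 l1 l3 x
    + lie_der a torsion_form l1 l3 l2 x + lie_der a torsion_form l2 l3 l1 x).
  rewrite /d_A0 /actA [X in anchor _ X](_ : _ = fun y => 6%:R^-1 *
    (3%:R * eval3 T l1 l2 l3 y + - 2%:R * eval3 C l1 l2 l3 y
     + - 2%:R * eval3 C l2 l1 l3 y + 1 * eval3 T l1 l3 l2 y + 1 * eval3 T l2 l3 l1 y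
     + 0 * eval3 T l1 l2 l3 y)) //.
  rewrite anchor_fun6; [|exact: sT'|exact: sC'|exact: sC'|exact: sT'|exact: sT'|exact: sT'].
  rewrite !anchor_funZ; try exact: eval3_smooth.
  have nE m1 m2 m3 : smooth_section setT m1 -> smooth_section setT m2 ->
    smooth_section setT m3 ->
    eval3 n m1 m2 m3 x = 6%:R^-1 * (3%:R * torsion_form m1 m2 m3 x
    - 2%:R * nabla_form D w m1 m2 m3 x - 2%:R * nabla_form D w m2 m1 m3 x
    + torsion_form m1 m3 m2 x + torsion_form m2 m3 m1 x).
    move=> sm1 sm2 sm3; rewrite -!TE // -!CE // /n /eval3; ring.
  rewrite !nE // !TE // !CE // /lie_der; ring.
rewrite dn.
have -> : eval3 (contract1 (symmetrize s) a) l1 l2 l3 x = 6%:R^-1 *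
    (eval3 (contract1 s a) l1 l2 l3 x + eval3 (contract1 s a) l2 l1 l3 x
     + eval3 (contract1 s a) l1 l3 l2 x + eval3 (contract1 s a) l2 l3 l1 x
     + eval3 (contract1 s a) l3 l1 l2 x + eval3 (contract1 s a) l3 l2 l1 x) by [].
rewrite !(tilde_atiyahE hs) //.
rewrite -!atiyah_form_swap12 //.
have -> : lie_der a (nabla_form D w) l1 l2 l3 x =
    - (atiyah_form a l1 l2 l3 x - atiyah_form a l1 l3 l2 x).
  by rewrite atiyah_form_swap23 // opprK.
have -> : lie_der a (nabla_form D w) l2 l1 l3 x =
    - (atiyah_form a l2 l1 l3 x - atiyah_form a l2 l3 l1 x).
  by rewrite atiyah_form_swap23 // opprK.
have n6 : 6%:R != 0 :> K by rewrite pnatr_eq0.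
by field.
Qed.

End Cocycles.

Theorem theorem4p6 (R : realType) (k : base_field) (M : manifold R)
    (P : lie_pair k M) (w : forall x : M, quot_bundle P x -> quot_bundle P x -> base_scalar R k)
    (D : (forall x : M, ambient P x) -> (forall x : M, quot_bundle P x) ->
         forall x : M, quot_bundle P x)
    (hw : symplectic_form w) (hD : connection D) (hA : extends_action D) :
  (exists! s, tilde_atiyah w D s) /\
  (forall s, tilde_atiyah w D s ->
     class_in_S3 s /\ (symplectic_connection w D -> sym_cochain1 s)).
Proof.
split.
  have [s hs] := tilde_atiyah_exists hD hA hw; exists s; split=> // t.
  exact: (tilde_atiyah_unique hs).
move=> s hs; split; last exact: tilde_atiyah_symplectic.
have cs : cochain1 s by case: hs.
have ds := tilde_atiyah_closed hD hA hw hs.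
split=> //; exists (symmetrize s); split.
- exact: symmetrize_cochain.
- exact: symmetrize_closed.
- exact: (symmetrize_cohomologous hD hA hw hs).
Qed.
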